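(* Let $V\simeq\mathbb{C}^n$, $1\le\ell\le n-1$, and let $(\alpha^1,\dots,\alpha^{2k},\square,\dots,\square)$ be a Schubert problem for $\mathrm{Gr}(\ell,V)$ in which $\alpha^1,\dots,\alpha^{2k}$ are followed by $t$ copies of $\square=(n-\ell,n-\ell+2,\dots,n)$, with $s=2k+t$ and $\alpha^{2i-1}_j+\alpha^{2i}_{\ell+1-j}\ge n+1$ for all $i=1,\dots,k$ and $j=1,\dots,\ell$. Let $F^1_\bullet,\dots,F^s_\bullet$ be general (complete) flags in $V$. For $i=1,\dots,k$ let $\Phi^i$ be an invertible $n\times n$ matrix with $F^{2i-1}_\bullet=R_\bullet(\Phi^i)$ and $F^{2i}_\bullet=R_\bullet(w_0\Phi^i)$, and for $j=1,\dots,t$ let $\Psi^j$ be an $(n-\ell)\times n$ matrix whose row span is $F^{2k+j}_{n-\ell}$. Then the system of equations $$(M\Phi^k)(\Phi^i)^{-1}N_i=0_{\ell\times(n-\ell)}\quad\text{for } i=1,\dots,k-1,\qquad \det\begin{pmatrix}M\Phi^k\\ \Psi^j\end{pmatrix}=0\quad\text{for } j=1,\dots,t,$$ where $(M,N_1,\dots,N_{k-1})\in\mathcal{M}_{\alpha^{2k-1}}^{\alpha^{2k}}\times\mathcal{N}_{\alpha^1}^{\alpha^2}\times\dots\times\mathcal{N}_{\alpha^{2k-3}}^{\alpha^{2k-2}}$, defines the instance $$X_{\alpha^1}F^1_\bullet\cap\dots\cap X_{\alpha^{2k}}F^{2k}_\bullet\cap X_{\square}F^{2k+1}_\bullet\cap\dots\cap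 X_{\square}F^{2k+t}_\bullet$$ of the Schubert problem (via $(M,N_1,\dots,N_{k-1})\mapsto R_\ell(M\Phi^k)$, which identifies the set of common zeroes bijectively with the points of the intersection) as the common zeroes of $(k-1)\cdot\ell(n-\ell)$ bilinear equations and $t$ determinantal equations in $$\sum_{i=1}^{k}\bigl(\ell(n-\ell)-|\alpha^{2i-1}|-|\alpha^{2i}|\bigr)=k\cdot\ell(n-\ell)-\sum_{i=1}^{2k}|\alpha^i|=(k-1)\cdot\ell(n-\ell)+t$$ variables, exhibiting the Schubert problem as a square system of equations (as many equations as variables).
   Context: Notation. $[n]=\{1,\dots,n\}$. Fix a basis $e_1,\dots,e_n$ of the complex vector space $V$ corresponding to columns of matrices. $\mathrm{Gr}(\ell,V)$ is the Grassmannian of $\ell$-dimensional linear subspaces of $V$. For a full rank matrix $M$ with $n$ columns, $R_\ell(M)$ is the span of its first $\ell$ rows; for an invertible $n\times n$ matrix $\Phi$, $R_\bullet(\Phi)$ is the complete flag $R_1(\Phi)\subsetneq\dots\subsetneq R_n(\Phi)=V$. $w_0$ is the permutation $i\mapsto n+1-i$ (and its permutation matrix), so $w_0\Phi$ is $\Phi$ with its rows in reverse order. Any two flags in linear general position ($\dim F_i\cap F'_j=\max\{0,i+j-n\}$ for all $i,j$) have the form $R_\bullet(\Phi),R_\bullet(w_0\Phi)$ for some invertible $\Phi$. Schubert varieties. $\binom{[n]}{\ell}$ is the set of increasing sequences $\alpha=(\alpha_1<\dots<\alpha_\ell)$ in $[n]$. For a complete flag $F_\bullet$, $X_\alpha F_\bullet=\{H\in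 \mathrm{Gr}(\ell,V):\dim(H\cap F_{\alpha_i})\ge i,\ i=1,\dots,\ell\}$, of codimension $|\alpha|=\ell(n-\ell)-\sum_i(\alpha_i-i)$. A Schubert problem is a list of elements of $\binom{[n]}{\ell}$ whose codimensions $|\cdot|$ sum to $\ell(n-\ell)$ (the trivial condition $(n-\ell+1,\dots,n)$ is allowed). The condition $\square=(n-\ell,n-\ell+2,n-\ell+3,\dots,n)$ is the one with $|\square|=1$; some of $\alpha^1,\dots,\alpha^{2k}$ may also equal $\square$. ''General flags'' means that the tuple of flags lies in a suitable dense Zariski open subset of the product of the varieties of complete flags. Local coordinates. For $\alpha,\beta\in\binom{[n]}{m}$ with $\alpha_i+\beta_{m+1-i}\ge n+1$ for all $i$, $\mathcal{M}_\alpha^\beta$ is the set of $m\times n$ matrices $(m_{i,j})$ with $m_{i,j}=0$ if $j<n+1-\beta_{m+1-i}$ or $j>\alpha_i$, $m_{i,j}=1$ if $j=n+1-\beta_{m+1-i}$, and $m_{i,j}$ otherwise free. For $\alpha\in\binom{[n]}{\ell}$, $\alpha^\perp\in\binom{[n]}{n-\ell}$ is defined by: $j\in\alpha^\perp$ iff $n+1-j\notin\alpha$. For $\alpha,\beta\in\binom{[n]}{\ell}$ with $\alpha_i+\beta_{\ell+1-i}\ge n+1$ for all $i$, $\mathcal{N}_\alpha^\beta=\{M^T: M\in\mathcal{M}^{\alpha^\perp}_{\beta^\perp}\}$ (lower index $\beta^\perp$, upper index $\alpha^\perp$), a set of $n\times(n-\ell)$ matrices. $\mathcal{M}_\alpha^\beta$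 and $\mathcal{N}_\alpha^\beta$ are affine spaces of dimension $\ell(n-\ell)-|\alpha|-|\beta|$; their free entries are the variables. *)

(* Defs.v *)
From mathcomp Require Import all_boot all_order all_algebra perm.
From mathcomp Require Import classical_sets functions reals.
From mathcomp.real_closed Require Export complex.
From mathcomp Require Export mpoly.
Set Implicit Arguments.
Unset Strict Implicit.
Unset Printing Implicit Defensive.
Import Order.TTheory GRing.Theory Num.Theory.
Local Open Scope classical_set_scope.
Local Open Scope ring_scope.

(* Indices and entries of Schubert conditions are 1-based, as in [n] = {1..n}.
   Ordinals ('I_k, 'I_n, ...) are 0-based, so i : 'I_k is the index i.+1. *)

Definition part (a : seq nat) (i : nat) : nat := nth 0%N a i.-1.

(* a is an element of binom([n], l) *)
Definition schubert_cond (n l : nat) (a : seq nat) : bool :=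
  [&& size a == l, sorted ltn a & all (fun x => 1 <= x <= n)%N a].

(* int-valued, so that no subtraction is truncated *)
Definition codim (n l : nat) (a : seq nat) : int :=
  (l * (n - l))%N%:Z - \sum_(1 <= i < l.+1) ((part a i)%:Z - i%:Z).

Definition square_cond (n l : nat) : seq nat :=
  (n - l)%N :: iota (n - l + 2) l.-1.

Definition perp (n : nat) (a : seq nat) : seq nat :=
  [seq j <- iota 1 n | (n.+1 - j)%N \notin a].

Definition schubert_problem (n l : nat) (p : seq (seq nat)) : Prop :=
  all (schubert_cond n l) p /\
  \sum_(a <- p) codim n l a = (l * (n - l))%N%:Z.

Section Flags.
Variable K : fieldType.

Section Rows.
Variable n : nat.
Local Notation V := 'rV[K]_n.

(* R_j(M): span of the first j rows of M (of all rows if there are fewer) *)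
Definition rows_span m (M : 'M[K]_(m, n)) (j : nat) : {vspace V} :=
  <<[seq row i M | i : 'I_m <- enum 'I_m & (i < j)%N]>>%VS.

(* A flag F_1 < ... < F_n = V is extended by F_0 = 0 and F_j = V for j > n,
   which makes it the same as a function on nat. *)
Definition complete_flag (F : nat -> {vspace V}) : Prop :=
  (forall j, \dim (F j) = minn j n) /\
  (forall i j, (i <= j)%N -> (F i <= F j)%VS).

Definition w0 : 'S_n := perm (@rev_ord_inj n).

Definition schubert_variety (l : nat) (a : seq nat) (F : nat -> {vspace V}) :
    set {vspace V} :=
  [set H | \dim H = l /\
     forall i, (1 <= i <= l)%N -> (i <= \dim (H :&: F (part a i))%VS)%N].

(* Zariski topology on the product of s copies of the flag variety, which
   carries the quotient topology for Phi |-> R(Phi) : GL_n -> B \ GL_n. *)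

Definition flag_product (s : nat) : set ('I_s -> nat -> {vspace V}) :=
  [set F | forall i, complete_flag (F i)].

Definition all_entries s (Phi : 'I_s -> 'M[K]_n)
    (v : 'I_#|{: 'I_s * 'I_n * 'I_n}|) : K :=
  let: (r, i, j) := enum_val v in Phi r i j.

Definition zariski_open s (U : set ('I_s -> nat -> {vspace V})) : Prop :=
  U `<=` @flag_product s /\
  exists P : set {mpoly K[#|{: 'I_s * 'I_n * 'I_n}|]},
    forall Phi : 'I_s -> 'M[K]_n, (forall i, Phi i \in unitmx) ->
      (U (fun i => rows_span (Phi i)) <->
       exists2 p, P p & p.@[all_entries Phi] != 0).

Definition zariski_dense s (U : set ('I_s -> nat -> {vspace V})) : Prop :=
  forall W, zariski_open W -> W !=set0 -> U `&` W !=set0.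

End Rows.

(* Coordinates M_a^b on m x n matrices; i and j are 1-based here. *)

Definition forced0 (n m : nat) (a b : seq nat) (i j : nat) : bool :=
  ((j < n.+1 - part b (m.+1 - i)) || (part a i < j))%N.

Definition forced1 (n m : nat) (a b : seq nat) (i j : nat) : bool :=
  (j == n.+1 - part b (m.+1 - i))%N.

Definition coordM (n m : nat) (a b : seq nat) : set 'M[K]_(m, n) :=
  [set M : 'M[K]_(m, n) | forall (i : 'I_m) (j : 'I_n),
     (forced0 n m a b i.+1 j.+1 -> M i j = 0) /\
     (forced1 n m a b i.+1 j.+1 -> M i j = 1)].

(* N_a^b = transposes of M_(b^perp)^(a^perp) *)
Definition coordN (n l : nat) (a b : seq nat) : set 'M[K]_(n, n - l) :=
  [set M^T | M in @coordM n (n - l) (perp n b) (perp n a)].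

End Flags.

(* positions of the free entries of M_a^b *)
Definition freeM (n m : nat) (a b : seq nat) : finType :=
  {p : 'I_m * 'I_n | ~~ forced0 n m a b p.1.+1 p.2.+1
                     && ~~ forced1 n m a b p.1.+1 p.2.+1}.

Lemma pair_fst_subproof k (i : 'I_k) : (2 * i < 2 * k)%N.
Proof. by rewrite ltn_pmul2l. Qed.

Lemma pair_snd_subproof k (i : 'I_k) : ((2 * i).+1 < 2 * k)%N.
Proof. by rewrite !mul2n ltn_Sdouble. Qed.

(* For the 1-based index i of the i-th pair, the indices 2i-1 and 2i. *)
Definition pair_fst k (i : 'I_k) : 'I_(2 * k) := Ordinal (pair_fst_subproof i).
Definition pair_snd k (i : 'I_k) : 'I_(2 * k) := Ordinal (pair_snd_subproof i).

Lemma last_pair_subproof k : (0 < k)%N -> (k.-1 < k)%N.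
Proof. by rewrite ltn_predL. Qed.

(* The 1-based index k, and the inclusion of {1..k-1} in {1..k}. *)
Definition last_pair k (hk : (0 < k)%N) : 'I_k :=
  Ordinal (last_pair_subproof hk).
Definition early_pair k (i : 'I_k.-1) : 'I_k := widen_ord (leq_pred k) i.

Section System.
Variables (K : fieldType) (n l k : nat) (hk : (0 < k)%N).
Variable alpha : 'I_(2 * k) -> seq nat.

Definition unknowns : Type :=
  ('M[K]_(l, n) * {ffun 'I_k.-1 -> 'M[K]_(n, n - l)})%type.

Definition coordMN : set unknowns :=
  [set MN : unknowns |
     coordM (alpha (pair_fst (last_pair hk)))
                   (alpha (pair_snd (last_pair hk))) MN.1 /\
     forall i : 'I_k.-1,
       coordN (alpha (pair_fst (early_pair i)))
                     (alpha (pair_snd (early_pair i))) (MN.2 i)].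

Definition varsM : finType :=
  @freeM n l (alpha (pair_fst (last_pair hk)))
             (alpha (pair_snd (last_pair hk))).
Definition varsN (i : 'I_k.-1) : finType :=
  @freeM n (n - l) (perp n (alpha (pair_snd (early_pair i))))
                   (perp n (alpha (pair_fst (early_pair i)))).
Definition variables : finType := (varsM + {i : 'I_k.-1 & varsN i})%type.

Definition free_entry (MN : unknowns) (v : variables) : K :=
  match v with
  | inl p => MN.1 (val p).1 (val p).2
  | inr (existT i p) => MN.2 i (val p).2 (val p).1
  end.

Definition free_entries (MN : unknowns) (v : 'I_#|variables|) : K :=
  free_entry MN (enum_val v).

Definition in_M (v : variables) : bool :=
  if v is inl _ then true else false.
Definition in_N (i : 'I_k.-1) (v : variables) : bool :=
  if v is inr u then tag u == i else false.

(* Degree at most one in the entries of M and at most one in those of N_i, with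
   no other variable. Terms of lower degree come from the entries of M and N_i
   that are equal to 1. *)
Definition bilinear_eqn (i : 'I_k.-1) (p : {mpoly K[#|variables|]}) : Prop :=
  forall m, m \in msupp p ->
    [/\ (\sum_(v : variables | in_M v) m (enum_rank v) <= 1)%N,
        (\sum_(v : variables | in_N i v) m (enum_rank v) <= 1)%N
      & forall v : variables, ~~ in_M v -> ~~ in_N i v ->
          m (enum_rank v) = 0%N].

End System.

Arguments free_entry {K n l k} hk alpha MN v.
Arguments free_entries {K n l k} hk alpha MN v.

(* one bilinear equation for each i and each entry of an l x (n-l) matrix, and
   one determinantal equation for each of the t copies of the square condition *)
Definition equations (n l k t : nat) : finType :=
  ('I_k.-1 * ('I_l * 'I_(n - l)) + 'I_t)%type.

Definition stack (K : fieldType) (n l : nat) (hl : (l <= n)%N)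
    (M : 'M[K]_(l, n)) (Psi : 'M[K]_(n - l, n)) : 'M[K]_n :=
  castmx (subnKC hl, erefl n) (col_mx M Psi).

(* Main.v *)
Require Import Defs.
From mathcomp Require Import all_boot all_order all_algebra perm zify.
From mathcomp Require Import boolp classical_sets functions reals.
Import Order.TTheory GRing.Theory Num.Theory.

(* For general flags every H in the intersection lies in the open cells where
   the coordinates M and N_i exist and are unique; this holds by a dimension
   count on the incidence variety of pairs (flags, H). In the coordinates of a
   chart of the Grassmannian, a flag with frame Phi_r that meets H in relative
   position a_r has Phi_r = (1 + b_r) D_r (1 - b_0), where b_r and D_r are
   matrices with prescribed zeros, b_0 is the point H of the chart, and the
   number of parameters is n^2 minus the codimension of a_r for each flag, plus
   l(n - l) for H. If some H lies in a smaller Schubert cell, there are too few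
   parameters; if it lies in the right cells but is not transversal to a pair of
   flags, a nontrivial determinant in the entries of two matrices D_r vanishes.
   Since N + 1 polynomials in N variables are algebraically dependent, in both
   cases the frames satisfy a nontrivial polynomial equation, and its
   complement is the required open set.

   For such an H the i-th row of M spans the line of the intersection of H,
   F_(alpha_i) and F'_(beta_(l+1-i)), and the columns of N are linear forms that
   vanish on H and on suitable subspaces of the two flags. *)

Set Implicit Arguments.
Unset Strict Implicit.
Unset Printing Implicit Defensive.
Local Open Scope ring_scope.

(** * Algebraic dependence and images of hypersurfaces *)

(** That the flags of a pair are opposite does not yet put [H] into the coordinates: normalizing row
    [i] of [M] needs [H], [F_(alpha_i)] and a member of [F'] one level below the expected one to
    meet trivially, and column [i] of [N] needs the dual statement on sums. Each of these concerns
    one pair, but the possible [H] depend on all flags, so every [H] has to be controlled at once,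
    by bounding the set of bad tuples of frames. No dimension theory is used: a set of frames is
    negligible if a nonzero polynomial vanishes on it, and that polynomial comes from counting
    monomials. In the expected cells there are exactly as many parameters as frame entries, since
    the codimensions add up to [l(n - l)]; the missing dimension is won by the vanishing
    determinant. It is nontrivial because the two flags of a pair have independent matrices [D_r],
    whose entries can be chosen to make it 1. Badness depends on the flags only, so one frame off
    the hypersurface certifies a tuple of flags. *)

Section LinearRelation.
Variable K : fieldType.

Lemma linear_relation (I J : finType) (A : I -> J -> K) :
  (#|J| < #|I|)%N ->
  exists2 c : I -> K, exists i, c i != 0 & forall j, \sum_i c i * A i j = 0.
Proof.
move=> ltJI.
pose B := \matrix_(i < #|I|, j < #|J|) A (enum_val i) (enum_val j).
have : kermx B != 0.
  rewrite -mxrank_eq0 mxrank_ker subn_eq0 -ltnNge.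
  exact: leq_ltn_trans (rank_leq_col B) ltJI.
case/rowV0Pn => c /sub_kermxP cB0 /rV0Pn [i ci].
exists (fun i => c 0 (enum_rank i)).
  by exists (enum_val i); rewrite enum_valK.
move=> j; have /matrixP/(_ 0 (enum_rank j)) := cB0.
rewrite !mxE => cBj; apply: etrans cBj.
rewrite (reindex (@enum_val I xpredT)) /=; last first.
  by exists enum_rank => x _; rewrite ?enum_valK ?enum_rankK.
by apply: eq_bigr => x _; rewrite !mxE enum_valK enum_rankK.
Qed.

End LinearRelation.

Section PolynomialRelation.
Variables (K : fieldType) (m : nat).
Implicit Types p q : {mpoly K[m]}.

Definition degree_le p d := {in msupp p, forall mu, (mdeg mu <= d)%N}.

Lemma degree_le_size p : degree_le p (msize p).
Proof. by move=> mu /msize_mdeg_lt/ltnW. Qed.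

Lemma degree_leW p d e : (d <= e)%N -> degree_le p d -> degree_le p e.
Proof. by move=> de pd mu /pd /leq_trans; apply. Qed.

Lemma degree_le1 : degree_le 1 0.
Proof. by move=> mu; rewrite -mpolyC1 msupp1 inE => /eqP ->; rewrite mdeg0. Qed.

Lemma degree_leM p q d e : degree_le p d -> degree_le q e ->
  degree_le (p * q) (d + e).
Proof.
move=> pd qe mu /msuppM_le /allpairsP [[a b] /= [ap bq ->]].
by rewrite mdegD leq_add ?pd ?qe.
Qed.

Lemma degree_leX p d i : degree_le p d -> degree_le (p ^+ i) (d * i).
Proof.
move=> pd; elim: i => [|i IHi]; first by rewrite muln0; apply: degree_le1.
by rewrite exprS mulnS; apply: degree_leM.
Qed.

Lemma degree_le_prod (I : finType) (F : I -> {mpoly K[m]}) d :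
  (forall i, degree_le (F i) d) -> degree_le (\prod_i F i) (#|I| * d).
Proof.
move=> Fd; rewrite cardE -big_enum /=.
elim: (enum I) => [|i r IHr]; first by rewrite big_nil; apply: degree_le1.
by rewrite big_cons mulSn; apply: degree_leM.
Qed.

(** There are [(d + 1)^(N + 1)] products with exponents up to [d], while their degrees grow linearly
    in [d], so they lie in a space of dimension of order [d^m] with [m <= N]. *)
Lemma polynomial_relation (N : nat) (f : 'I_N -> {mpoly K[m]})
    (q : {mpoly K[m]}) : (m <= N)%N ->
  exists (d : nat) (c : {ffun 'I_N -> 'I_d.+1} * 'I_d.+1 -> K),
    (exists e, c e != 0) /\
    \sum_e c e *: (\prod_i f i ^+ e.1 i * q ^+ e.2) = 0.
Proof.
move=> leMN.
pose s := (msize q + \max_i msize (f i))%N.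
(* [k] is chosen so that [D + 1 <= k (d + 1)]; with [d = k^m] this gives [(D + 1)^m <= d (d + 1)^m <
   (d + 1)^(m + 1)]. *)
pose k := (N.+1 * s).+1; pose d := (k ^ m)%N.
pose F (e : {ffun 'I_N -> 'I_d.+1} * 'I_d.+1) : {mpoly K[m]} :=
  \prod_i f i ^+ e.1 i * q ^+ e.2.
pose D := (N.+1 * (s * d))%N.
have degF e : degree_le (F e) D.
  rewrite /D mulSn addnC; apply: degree_leM.
    rewrite -[X in (X * _)%N]card_ord; apply: degree_le_prod => i.
    apply: (@degree_leW _ (s * e.1 i)).
      by rewrite leq_mul2l -ltnS ltn_ord orbT.
    apply: degree_leX; apply: (degree_leW _ (@degree_le_size _)).
    exact: leq_trans (@leq_bigmax _ (fun i => msize (f i)) i) (leq_addl _ _).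
  apply: (@degree_leW _ (s * e.2)).
    by rewrite leq_mul2l -ltnS ltn_ord orbT.
  by apply: degree_leX; apply: (degree_leW _ (@degree_le_size _)); apply: leq_addr.
(* The box of exponents up to [D] contains all monomials of degree at most [D] and is easier to
   count. *)
pose J : finType := {ffun 'I_m -> 'I_D.+1}.
pose A e (mu : J) := (F e)@_[multinom nat_of_ord (mu i) | i < m].
have card_lt : (#|J| < #|{: {ffun 'I_N -> 'I_d.+1} * 'I_d.+1}|)%N.
  rewrite card_prod !card_ffun !card_ord.
  have leDk : (D.+1 <= k * d.+1)%N.
    by rewrite /D /k mulnA mulSn mulnS; lia.
  have le1 : (D.+1 ^ m <= d * d.+1 ^ m)%N.
    rewrite /d -expnMn; move: leDk; case: (posnP m) => [->|m0] //.
    by rewrite leq_exp2r.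
  apply: leq_ltn_trans le1 _; apply: (@leq_trans (d.+1 ^ m * d.+1)).
    by rewrite mulnC ltn_mul2l expn_gt0 ltnSn.
  by rewrite leq_mul2r leq_pexp2l ?orbT.
have [c [e ce] cA] := linear_relation A card_lt.
exists d, c; split; first by exists e.
apply/mpolyP => mu; rewrite mcoeff0 raddf_sum /=.
have [muD|muD] := leqP (mdeg mu) D; last first.
  apply: big1 => e' _; rewrite mcoeffZ (memN_msupp_eq0 (m := mu)) ?mulr0 //.
  by apply: contraL muD => /degF; rewrite -leqNgt.
have mui i : (mu i < D.+1)%N.
  by rewrite ltnS (leq_trans _ muD) // mdegE (bigD1 i) //= leq_addr.
rewrite -[RHS](cA [ffun i => Ordinal (mui i)]).
apply: eq_bigr => e' _; rewrite mcoeffZ /A; congr (_ * _@_ _).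
by apply/mnmP => i; rewrite mnmE ffunE.
Qed.

End PolynomialRelation.

(** * Polynomial functions and sets contained in a hypersurface *)

Section PolynomialFunctions.
Variable K : fieldType.

Definition polyfun (T : finType) (g : (T -> K) -> K) : Prop :=
  exists p : {mpoly K[#|T|]}, forall x, g x = p.@[fun v => x (enum_val v)].

Definition small (I : finType) (B : (I -> K) -> Prop) : Prop :=
  exists2 P : {mpoly K[#|I|]}, P != 0 &
    forall y, B y -> P.@[fun v => y (enum_val v)] = 0.

Section Closure.
Variable T : finType.
Implicit Types g h : (T -> K) -> K.

Lemma polyfun_ext g h : g =1 h -> polyfun g -> polyfun h.
Proof. by move=> gh [p gp]; exists p => x; rewrite -gh. Qed.

Lemma polyfunC c : polyfun (fun _ : T -> K => c).
Proof. by exists c%:MP => x; rewrite mevalC. Qed.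

Lemma polyfunX t : polyfun (fun x : T -> K => x t).
Proof. by exists 'X_(enum_rank t) => x; rewrite mevalXU enum_rankK. Qed.

Lemma polyfunD g h : polyfun g -> polyfun h -> polyfun (fun x => g x + h x).
Proof. by move=> [p gp] [q hq]; exists (p + q) => x; rewrite mevalD gp hq. Qed.

Lemma polyfunM g h : polyfun g -> polyfun h -> polyfun (fun x => g x * h x).
Proof. by move=> [p gp] [q hq]; exists (p * q) => x; rewrite mevalM gp hq. Qed.

Lemma polyfun_sum (I : Type) (r : seq I) (P : pred I) (g : I -> (T -> K) -> K) :
  (forall i, polyfun (g i)) -> polyfun (fun x => \sum_(i <- r | P i) g i x).
Proof.
move=> gP; elim: r => [|i r IHr].
  by apply: polyfun_ext (polyfunC 0) => x; rewrite big_nil.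
case Pi: (P i).
  by apply: polyfun_ext (polyfunD (gP i) IHr) => x; rewrite big_cons Pi.
by apply: polyfun_ext IHr => x; rewrite big_cons Pi.
Qed.

Lemma polyfun_prod (I : Type) (r : seq I) (P : pred I) (g : I -> (T -> K) -> K) :
  (forall i, polyfun (g i)) -> polyfun (fun x => \prod_(i <- r | P i) g i x).
Proof.
move=> gP; elim: r => [|i r IHr].
  by apply: polyfun_ext (polyfunC 1) => x; rewrite big_nil.
case Pi: (P i).
  by apply: polyfun_ext (polyfunM (gP i) IHr) => x; rewrite big_cons Pi.
by apply: polyfun_ext IHr => x; rewrite big_cons Pi.
Qed.

Lemma polyfun_mulmx m n p (A : (T -> K) -> 'M[K]_(m, n))
    (B : (T -> K) -> 'M[K]_(n, p)) :
  (forall i j, polyfun (fun x => A x i j)) ->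
  (forall i j, polyfun (fun x => B x i j)) ->
  forall i j, polyfun (fun x => (A x *m B x) i j).
Proof.
move=> AP BP i j; have P1 k := polyfunM (AP i k) (BP k j).
apply: polyfun_ext (polyfun_sum (index_enum _) xpredT P1) => x.
by rewrite mxE.
Qed.

Lemma polyfun_det n (A : (T -> K) -> 'M[K]_n) :
  (forall i j, polyfun (fun x => A x i j)) -> polyfun (fun x => \det (A x)).
Proof.
move=> AP; apply: polyfun_sum => s; apply: polyfunM; first exact: polyfunC.
by apply: polyfun_prod => i; apply: AP.
Qed.

End Closure.

Section Small.
Variable I : finType.

Lemma smallS (A B : (I -> K) -> Prop) :
  (forall y, A y -> B y) -> small B -> small A.
Proof. by move=> AB [P P0 PB]; exists P => // y /AB /PB. Qed.

Lemma small_bigU (C : finType) (B : C -> (I -> K) -> Prop) :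
  (forall c, small (B c)) -> small (fun y => exists c, B c y).
Proof.
move=> sB; have /fin_all_exists2 [P P0 PB] :
    forall c, exists2 P : {mpoly K[#|I|]}, P != 0 &
      forall y, B c y -> P.@[fun v => y (enum_val v)] = 0 by [].
exists (\prod_c P c); first by apply/prodf_neq0 => c _.
move=> y [c /PB yc].
by rewrite (bigD1 c) //= mevalM yc mul0r.
Qed.

Lemma smallU (A B : (I -> K) -> Prop) :
  small A -> small B -> small (fun y => A y \/ B y).
Proof.
move=> [P P0 PA] [Q Q0 QB]; exists (P * Q); first by rewrite mulf_neq0.
by move=> y [/PA|/QB] E; rewrite mevalM E ?mul0r ?mulr0.
Qed.

(* Among N + 1 polynomials f_1, ..., f_N, q in at most N variables there is a
   relation; divided by the largest possible power of q, it becomes a relation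
   between the f_i alone on the hypersurface q = 0. *)
Lemma small_image (T : finType) (f : (T -> K) -> I -> K) (q : (T -> K) -> K)
    (x0 : T -> K) :
  (#|T| <= #|I|)%N -> (forall i, polyfun (fun x => f x i)) -> polyfun q ->
  q x0 != 0 ->
  small (fun y => exists2 x, q x = 0 & y =1 f x).
Proof.
move=> leTI fP [qp qE] qx0.
have /fin_all_exists [fp fE] (v : 'I_#|I|) : exists p : {mpoly K[#|T|]},
  forall x, f x (enum_val v) = p.@[fun w => x (enum_val w)] by apply: fP.
have qp0 : qp != 0.
  by apply: contraNneq qx0 => qp0; rewrite qE qp0 meval0.
have [d [c [[[e1 j1] c1] rel]]] := polynomial_relation fp qp leTI.
pose lead j := [exists e, c (e, j) != 0].
have lead1 : lead j1 by apply/existsP; exists e1.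
(* [j0] is the least exponent of [q] in the relation; on [q = 0], after division by [q^j0], only the
   terms with exponent [j0] survive. *)
have [j0 /existsP[e0 c0] minj] := arg_minnP (P := lead) (@nat_of_ord d.+1) lead1.
have lt0 e (j : 'I_d.+1) : (j < j0)%N -> c (e, j) = 0.
  move=> ltj; apply/eqP; apply: contraLR ltj => cej.
  by rewrite -leqNgt minj //; apply/existsP; exists e.
pose mon (e : {ffun 'I_#|I| -> 'I_d.+1}) :=
  [multinom nat_of_ord (e i) | i < #|I|].
have mon_inj : injective mon.
  by move=> e e' /mnmP E; apply/ffunP => i; apply/val_inj; have := E i; rewrite !mnmE.
pose P : {mpoly K[#|I|]} := \sum_e c (e, j0) *: 'X_[mon e].
exists P.
  apply: contraNneq c0 => P0; have : P@_(mon e0) = 0 by rewrite P0 mcoeff0.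
  rewrite raddf_sum /= (bigD1 e0) //= big1 ?addr0 => [|e ne].
    by rewrite mcoeffZ mcoeffX eqxx mulr1 => E; rewrite E.
  by rewrite mcoeffZ mcoeffX (inj_eq mon_inj) (negPf ne) mulr0.
move=> y [x qx yf].
have G0 : \sum_e c e *: (\prod_i fp i ^+ e.1 i * qp ^+ (e.2 - j0)) = 0.
  apply: (mulfI (expf_neq0 j0 qp0)); rewrite mulr0; apply: etrans rel.
  rewrite mulr_sumr; apply: eq_bigr => -[e j] _ /=.
  case: (ltnP j j0) => [/lt0 ->|lej]; first by rewrite !scale0r mulr0.
  by rewrite -scalerAr mulrCA -exprD subnKC.
have := congr1 (meval (fun w => x (enum_val w))) G0.
rewrite meval0 raddf_sum /= => G1; apply: etrans G1.
rewrite raddf_sum /=.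
transitivity (\sum_e \sum_j
    (c (e, j) *: (\prod_i fp i ^+ e i * qp ^+ (j - j0))).@[fun w => x (enum_val w)]);
  last by rewrite pair_bigA; apply: eq_bigr => -[].
apply: eq_bigr => e _; rewrite (bigD1 j0) //= [X in _ + X]big1 ?addr0 => [|j nej].
  rewrite subnn expr0 mulr1 !mevalZ mevalX. rewrite rmorph_prod /=; congr (_ * _).
  by apply: eq_bigr => i _; rewrite mnmE rmorphXn /= yf fE.
case: (ltnP j j0) => [/lt0 ->|lej]; first by rewrite scale0r meval0.
rewrite mevalZ mevalM rmorphXn /= -qE qx expr0n subn_eq0 leqNgt ltn_neqAle lej.
by rewrite [val _ == _]eq_sym nej !mulr0.
Qed.

(** A dummy parameter [None] serves as [q]. Adding it costs one dimension, which the strict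
    inequality allows, and every point of the image is also reached with [None] set to 0. *)
Lemma small_image_lt (T : finType) (f : (T -> K) -> I -> K) :
  (#|T| < #|I|)%N -> (forall i, polyfun (fun x => f x i)) ->
  small (fun y => exists x, y =1 f x).
Proof.
move=> ltTI fP.
pose g (x : option T -> K) := f (fun t => x (Some t)).
have gP i : polyfun (fun x => g x i).
  have [p pE] := fP i; rewrite /g.
  apply: (@polyfun_ext _ (fun x : option T -> K =>
    p.@[fun v => x (Some (enum_val v))])) => [x|]; first by rewrite pE.
  apply: (@polyfun_ext _ (fun x : option T -> K =>
    \sum_(m <- msupp p) p@_m * \prod_v x (Some (enum_val v)) ^+ m v)) => [x|].
    by rewrite mevalE.
  apply: polyfun_sum => m; apply: polyfunM; first exact: polyfunC.
  apply: polyfun_prod => v; elim: (m v) => [|j IHj]; first exact: polyfunC.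
  apply: polyfun_ext (polyfunM (polyfunX _) IHj) => x /=; exact/esym/exprS.
have ltoI : (#|{: option T}| <= #|I|)%N by rewrite card_option.
have := small_image (x0 := fun _ => 1) ltoI gP (polyfunX None) (oner_neq0 _).
apply: smallS => y [x yx]; exists (fun t => if t is Some t then x t else 0) => //.
Qed.

End Small.
End PolynomialFunctions.

(** Uniqueness of base-[B] expansions, for the Kronecker substitution in [mpoly_nonroot]. *)
Lemma base_digits_inj (B n : nat) (a b : 'I_n -> nat) :
  (forall i, a i < B)%N -> (forall i, b i < B)%N ->
  (\sum_i a i * B ^ i)%N = (\sum_i b i * B ^ i)%N -> a =1 b.
Proof.
elim: n a b => [|n IHn] a b aB bB; first by move=> _ [].
have shift (c : 'I_n.+1 -> nat) : (\sum_i c i * B ^ i =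
    (\sum_(i < n) c (lift ord0 i) * B ^ i) * B + c ord0)%N.
  rewrite big_ord_recl muln1 addnC; congr (_ + _)%N.
  by rewrite big_distrl /=; apply: eq_bigr => i _; rewrite -mulnA -expnSr.
have B0 : (0 < B)%N by apply: leq_trans (aB ord0).
rewrite !shift => E; have E0 : a ord0 = b ord0.
  by have := congr1 (modn^~ B) E; rewrite !modnMDl !modn_small.
have /IHn E1 : (\sum_(i < n) a (lift ord0 i) * B ^ i =
    \sum_(i < n) b (lift ord0 i) * B ^ i)%N.
  by have := congr1 (divn^~ B) E; rewrite !divnMDl // !divn_small ?addn0.
by move=> i; case: (unliftP ord0 i) => [j ->|->] //; apply: E1.
Qed.

(** The substitution [x_i = t^(B^i)], with [B] above every exponent, sends distinct monomials to
    distinct powers of [t]. The resulting nonzero univariate polynomial has a nonroot among the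
    natural numbers, which are distinct in [K]. *)
Lemma mpoly_nonroot (K : numFieldType) (n : nat) (p : {mpoly K[n]}) :
  p != 0 -> exists v : 'I_n -> K, p.@[v] != 0.
Proof.
move=> p0; set B := msize p.
pose w (mu : 'X_{1..n}) := (\sum_i mu i * B ^ i)%N.
pose u : {poly K} := \sum_(mu <- msupp p) p@_mu *: 'X^(w mu).
have ltB mu i : mu \in msupp p -> (mu i < B)%N.
  move=> /msize_mdeg_lt; apply: leq_ltn_trans.
  by rewrite mdegE (bigD1 i) //= leq_addr.
have w_inj : {in msupp p &, injective w}.
  move=> a b ap bp /base_digits_inj E; apply/mnmP => i; apply: E => j; exact: ltB.
have u0 : u != 0.
  apply/eqP => /(congr1 (coefp (w (mlead p)))); rewrite /= coef0 coef_sum.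
  rewrite (bigD1_seq (mlead p)) ?mlead_supp ?msupp_uniq //= coefZ coefXn eqxx.
  rewrite mulr1 big_seq_cond big1 ?addr0 => [|mu /andP[mup ne]].
    by apply/eqP; rewrite -mcoeff_msupp mlead_supp.
  by rewrite coefZ coefXn (inj_in_eq w_inj) ?mlead_supp // eq_sym (negPf ne) mulr0.
have [t ut] : exists t, ~~ root u t.
  pose s : seq K := [seq i%:R | i <- iota 0 (size u)].
  have us : uniq s by rewrite map_inj_uniq ?iota_uniq //; apply: mulrIn (oner_neq0 K).
  have /allPn [t _ ut] : ~~ all (root u) s.
    apply: contraL (leqnn (size u)) => us0.
    rewrite -ltnNge -{1}(size_iota 0 (size u)).
    by rewrite -(size_map (fun i => i%:R : K)) max_poly_roots.
  by exists t.
exists (fun i => t ^+ (B ^ i)); apply: contraNneq ut => pt; apply/rootP.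
rewrite -{}pt mevalE horner_sum; apply: eq_bigr => mu _.
rewrite hornerZ hornerXn; congr (_ * _); rewrite /w expr_sum.
by apply: eq_bigr => i _; rewrite mulnC exprM.
Qed.

(** * Flags and adapted bases *)

Lemma card_ltn_ord (n u : nat) : (u <= n)%N -> #|[pred i : 'I_n | (i < u)%N]| = u.
Proof.
move=> un; rewrite -[RHS]card_ord -(card_codom (f := widen_ord un)); last first.
  by move=> i j /(congr1 val) /= /val_inj.
apply: eq_card => i; rewrite inE; apply/idP/codomP => [iu|[j ->]] /=.
  by exists (Ordinal iu); apply: val_inj.
exact: ltn_ord.
Qed.

Lemma big_ltn_ord_recr (T : Type) (idx : T) (op : Monoid.com_law idx)
    (n u : nat) (P : pred 'I_n) (F : 'I_n -> T) (un : (u < n)%N) :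
  \big[op/idx]_(i < n | (i < u.+1)%N && P i) F i =
  op (\big[op/idx]_(i < n | (i < u)%N && P i) F i)
     (if P (Ordinal un) then F (Ordinal un) else idx).
Proof.
have ltu (i : 'I_n) : (i < u.+1)%N && (i != Ordinal un) = (i < u)%N.
  by rewrite ltnS ltn_neqAle -val_eqE andbC.
case: ifP => Pu.
  rewrite (bigD1 (Ordinal un)) /= ?ltnSn ?Pu // Monoid.mulmC.
  by congr (op _ _); apply: eq_bigl => i; rewrite andbAC ltu.
rewrite Monoid.mulm1; apply: eq_bigl => i; rewrite -ltu.
by have [->|_] := eqVneq i; rewrite ?Pu ?andbF ?andbT.
Qed.

Section RowsSpan.
Variables (K : fieldType) (n : nat).
Local Notation V := 'rV[K]_n.

Lemma rows_spanE m (M : 'M[K]_(m, n)) j :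
  rows_span M j = (\sum_(i < m | (i < j)%N) <[row i M]>)%VS.
Proof.
by rewrite /rows_span span_def big_map big_filter big_enum_cond.
Qed.

Lemma mem_rows_span m (M : 'M[K]_(m, n)) j (x : V) :
  reflect (exists2 y : 'rV_m, (forall i : 'I_m, (j <= i)%N -> y 0 i = 0)
                              & x = y *m M)
          (x \in rows_span M j).
Proof.
rewrite rows_spanE; apply: (iffP memv_sumP) => [[vs vsP ->]|[y yj ->]].
  have /fin_all_exists [c cP] (i : 'I_m) : exists c, (i < j)%N -> vs i = c *: row i M.
    case: (ltnP i j) => [ij|_]; last by exists 0.
    by have /vlineP[c cE] := vsP i ij; exists c.
  exists (\row_i if (i < j)%N then c i else 0) => [i ji|].
    by rewrite mxE ltnNge ji.
  rewrite mulmx_sum_row [RHS](bigID (fun i : 'I_m => (i < j)%N)) /=.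
  rewrite [X in _ = _ + X]big1 ?addr0 => [|i /negPf ij]; last by rewrite mxE ij scale0r.
  by apply: eq_bigr => i ij; rewrite mxE ij cP.
exists (fun i => y 0 i *: row i M) => [i _|]; first by rewrite memvZ ?memv_line.
rewrite mulmx_sum_row (bigID (fun i : 'I_m => (i < j)%N)) /=.
rewrite [X in _ + X = _]big1 ?addr0 // => i; rewrite -leqNgt => /yj ->.
exact: scale0r.
Qed.

Lemma mem_rows_span_unit (M : 'M[K]_n) j (x : V) : M \in unitmx ->
  reflect (forall i : 'I_n, (j <= i)%N -> (x *m invmx M) 0 i = 0)
          (x \in rows_span M j).
Proof.
move=> uM; apply: (iffP (mem_rows_span _ _ _)) => [[y yj ->]|xj].
  by rewrite mulmxK.
by exists (x *m invmx M); rewrite // mulmxKV.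
Qed.

Lemma rows_spanS m (M : 'M[K]_(m, n)) i j :
  (i <= j)%N -> (rows_span M i <= rows_span M j)%VS.
Proof.
move=> ij; apply/subvP => x /mem_rows_span[y yi ->].
by apply/mem_rows_span; exists y => // k jk; rewrite yi // (leq_trans ij).
Qed.

Lemma dim_rows_span m (M : 'M[K]_(m, n)) j :
  row_free M -> \dim (rows_span M j) = minn j m.
Proof.
move=> frM; pose p (i : 'I_m) := (i < j)%N.
have free_rows : free [seq row i M | i <- enum 'I_m].
  pose X : m.-tuple V := [tuple row i M | i < m].
  suff : free X by [].
  apply/freeP => k /= kX i.
  have : \row_i k i *m M = 0.
    rewrite mulmx_sum_row -[RHS]kX; apply: eq_bigr => i' _.
    by rewrite mxE; congr (_ *: _); rewrite -(tnth_nth 0 X) tnth_mktuple.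
  move=> /eqP; rewrite mulmx_free_eq0 // => /eqP /rowP/(_ i); by rewrite !mxE.

have fr : free [seq row i M | i <- enum 'I_m & p i].
  apply: (catl_free (Y := [seq row i M | i <- enum 'I_m & predC p i])).
  rewrite -map_cat (perm_free (perm_map _ (permEl (perm_filterC p _)))).
  exact: free_rows.
rewrite (eqnP fr) size_map size_filter -sum1_count big_enum_cond sum1_card.
rewrite -[RHS](@card_ltn_ord m (minn j m)) ?geq_minr //.
by apply: eq_card => i; rewrite !inE /p ltn_min ltn_ord andbT.
Qed.

Lemma dim_rows_span_unit (M : 'M[K]_n) j :
  M \in unitmx -> \dim (rows_span M j) = minn j n.
Proof. by rewrite -row_free_unit; apply: dim_rows_span. Qed.

Lemma rows_span_fullv (M : 'M[K]_n) j :
  M \in unitmx -> (n <= j)%N -> rows_span M j = fullv.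
Proof.
move=> uM nj; apply/eqP; rewrite eqEdim subvf dim_rows_span_unit //.
by rewrite (minn_idPr nj) dimvf /dim /= mul1n.
Qed.

End RowsSpan.

Section Greedy.
Variables (K : fieldType) (n : nat).
Local Notation V := 'rV[K]_n.

Lemma addv_line_dim (U : {vspace V}) (v : V) :
  \dim (U + <[v]>) = (\dim U + (v \notin U))%N.
Proof.
have [vU|vU] := boolP (v \in U).
  by rewrite addn0 (addv_idPl _) // -memvE.
rewrite dimv_disjoint_sum ?dim_vline.
  by congr (_ + nat_of_bool _)%N; apply: contraNneq vU => ->; rewrite mem0v.
apply/eqP; rewrite -subv0; apply/subvP => x; rewrite memv_cap => /andP[xU].
case/vlineP => c xE; rewrite memv0 xE scaler_eq0; apply: contraNT vU.
rewrite negb_or => /andP[c0 _]; rewrite -[v]scale1r -(mulVf c0) -scalerA -xE.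
exact: memvZ.
Qed.

Lemma limg_rows_span p (f : 'Hom(V, 'rV[K]_p)) m (M : 'M_(m, n)) u :
  (f @: rows_span M u)%VS = (\sum_(i < m | (i < u)%N) <[f (row i M)]>)%VS.
Proof.
by rewrite rows_spanE limg_sum; apply: eq_bigr => i _; rewrite limg_line.
Qed.

(* a collects the rows of Phi that depend, modulo H, on the rows above them;
   the others form a basis of V / H adapted to the flag of Phi. *)
Lemma greedy_basis (H : {vspace V}) (Phi : 'M[K]_n) : Phi \in unitmx ->
  exists (a : {set 'I_n}) (b : 'M[K]_n),
  [/\ forall i j, b i j != 0 -> [/\ i \in a, j \notin a & (j < i)%N],
      forall i, i \in a -> row i ((1%:M - b) *m Phi) \in H
    & forall u, #|[pred i in a | (i < u)%N]| = \dim (H :&: rows_span Phi u)].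
Proof.
(* [f] has kernel [H], so its image serves as the quotient of the whole space by [H]. *)
move=> uPhi; pose f : 'End(V) := (\1 - projv H)%VF.
have kerf : lker f = H.
  apply/vspaceP => x; rewrite memv_ker add_lfunE opp_lfunE id_lfunE subr_eq0.
  apply/eqP/idP => [xH|/projv_id //]; rewrite [x]xH; exact: memv_proj.
pose R u := (\sum_(i < n | (i < u)%N) <[f (row i Phi)]>)%VS.
have RE u : (f @: rows_span Phi u)%VS = R u by apply: limg_rows_span.
pose a := [set i : 'I_n | f (row i Phi) \in R i].
pose S u := (\sum_(i < n | (i < u)%N && (i \notin a)) <[f (row i Phi)]>)%VS.
(* The images of the first [u] rows are spanned by those outside [a], each of which raises the
   dimension by one. *)
have RS u : (u <= n)%N ->
    R u = S u /\ \dim (R u) = (\sum_(i < n | (i < u)%N && (i \notin a)) 1)%N.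
  elim: u => [_|u IHu un]; first by rewrite /R /S !big_pred0 ?dimv0.
  have [RSu dimRu] := IHu (ltnW un); pose i := Ordinal un.
  have step : R u.+1 = (R u + <[f (row i Phi)]>)%VS.
    rewrite /R; under eq_bigl do rewrite -[(_ < _)%N]andbT.
    rewrite (big_ltn_ord_recr _ xpredT _ un) /=.
    by congr (_ + _)%VS; apply: eq_bigl => j; rewrite andbT.
  rewrite step /S !(big_ltn_ord_recr _ (fun i => i \notin a) _ un).
  rewrite -/i -/(S u) -RSu addv_line_dim dimRu.
  have -> : (i \in a) = (f (row i Phi) \in R u) by rewrite inE.
  case: ifP => [//|/negbFE iR].
  by rewrite !Monoid.mulm1 (addv_idPl _) // -memvE.
have /fin_all_exists [b bP] (i : 'I_n) : exists b : 'rV[K]_n,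
    (forall j, b 0 j != 0 -> [/\ i \in a, j \notin a & (j < i)%N]) /\
    (i \in a -> f (row i Phi) = \sum_j b 0 j *: f (row j Phi)).
  have [ia|ia] := boolP (i \in a); last first.
    by exists 0; split=> [j|//]; rewrite mxE eqxx.
  have [RSi _] := RS i (ltnW (ltn_ord i)).
  have := ia; rewrite inE RSi => /memv_sumP[vs vsP vsE].
  have /fin_all_exists [c cP] (j : 'I_n) : exists c,
      (j < i)%N && (j \notin a) -> vs j = c *: f (row j Phi).
    case: (boolP ((j < i)%N && (j \notin a))) => [/vsP/vlineP[c ->]|_].
      by exists c.
    by exists 0.
  pose P (j : 'I_n) := (j < i)%N && (j \notin a).
  exists (\row_j if P j then c j else 0); split=> [j|_].
    by rewrite mxE; case: ifP => [/andP[]//|]; rewrite eqxx.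
  rewrite vsE [RHS](bigID P) /= [X in _ + X]big1 ?addr0 => [|j /negPf Pj]; last first.
    by rewrite mxE Pj scale0r.
  by apply: eq_bigr => j Pj; rewrite mxE /P Pj cP.
exists a, (\matrix_i b i); split.
- by move=> i j; rewrite mxE; have [bi _] := bP i; apply: bi.
- move=> i ia; rewrite -kerf memv_ker mulmxBl mul1mx.
  rewrite linearB /= linearB /= subr_eq0; have [_ ->] := bP i => //.
  rewrite row_mul rowK mulmx_sum_row linear_sum /=; apply/eqP/eq_bigr => j _.
  by rewrite linearZ.
(* Rank-nullity for [f] on the span of the first [u] rows: the image has one dimension for each
   index outside [a], so the kernel has one for each index in [a]. *)
have count_a u : (u <= n)%N ->
    #|[pred i in a | (i < u)%N]| = \dim (H :&: rows_span Phi u).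
  move=> un; have [_ dimRu] := RS u un.
  have := limg_ker_dim f (rows_span Phi u).
  rewrite kerf RE dimRu dim_rows_span_unit // (minn_idPl un) capvC.
  move=> E0; have E : u = (#|[pred i in a | (i < u)%N]| +
                 \sum_(i < n | (i < u)%N && (i \notin a)) 1)%N.
    rewrite -[LHS](card_ltn_ord un) -!sum1_card (bigID (mem a)) /=.
    by congr (_ + _)%N; apply: eq_bigl => i; rewrite !inE andbC.
  apply: (@addIn (\sum_(i < n | (i < u)%N && (i \notin a)) 1)).
  by rewrite E0 -E.
move=> u; have [/count_a //|nu] := leqP u n.
have -> : rows_span Phi u = rows_span Phi n.
  by rewrite !rows_span_fullv // ltnW.
rewrite -count_a //; apply: eq_card => i; rewrite !inE ltn_ord.
by rewrite (ltn_trans (ltn_ord i) nu).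
Qed.

End Greedy.

(** * Schubert conditions as subsets *)

(** The adjoint of [part]: [part a i <= u] means [i <= cnt a u]. Through it, arguments about indices
    become linear arithmetic. *)
Definition cnt (s : seq nat) (u : nat) : nat := count (fun x => (x <= u)%N) s.

Lemma nth_leq_cnt (s : seq nat) i u : sorted ltn s -> (i < size s)%N ->
  (nth 0%N s i <= u)%N = (i < cnt s u)%N.
Proof.
elim: s i => [//|x s IHs] i /= xs; rewrite ltnS => lti.
have [xu|ux] := leqP x u; last first.
  have gt0 : all (fun y => (u < y)%N) s.
    apply/allP => y ys; apply: ltn_trans ux _.
    by move: xs; rewrite path_sortedE => [/andP[/allP/(_ y ys)]//|]; apply: ltn_trans.
  have c0 : cnt s u = 0%N.
    apply/eqP; rewrite -leqn0 leqNgt -has_count -all_predC.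
    by apply: sub_all gt0 => y /=; rewrite ltnNge.
  rewrite -/(cnt s u) c0 addn0 ltn0; case: i lti => [_|i lti] /=.
    by rewrite leqNgt ux.
  apply/negbTE; rewrite -ltnNge; exact: (all_nthP 0%N gt0).
case: i lti => [//|i lti] /=; rewrite -/(cnt s u) add1n ltnS.
by apply: IHs => //; apply: path_sorted xs.
Qed.

Lemma cnt_part n l (a : seq nat) i : schubert_cond n l a -> (1 <= i <= l)%N ->
  cnt a (part a i) = i /\ cnt a (part a i).-1 = i.-1.
Proof.
case/and3P => /eqP sza srt /allP bnd; case: i => [//|i] /=; rewrite -sza => il.
rewrite /part /=; split; apply/eqP; rewrite eqn_leq.
  rewrite -(nth_leq_cnt _ srt il) leqnn andbT leqNgt.
  have cs : (cnt a (nth 0%N a i) <= size a)%N by apply: count_size.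
  apply/negP => lti; have ltis : (i.+1 < size a)%N by apply: leq_trans lti cs.
  move: lti; rewrite -nth_leq_cnt // leqNgt.
  by rewrite (sorted_ltn_nth ltn_trans) // ?inE // ltnS.
have nth0 : (0 < nth 0%N a i)%N by have /andP[] := bnd _ (mem_nth 0%N il).
apply/andP; split.
  by rewrite leqNgt -nth_leq_cnt // -ltnNge prednK.
case: i il nth0 => [//|i] il nth0; rewrite -(nth_leq_cnt _ srt (ltnW il)).
by rewrite -ltnS prednK // (sorted_ltn_nth ltn_trans) // inE // ltnW.
Qed.

Lemma part_bounds n l (a : seq nat) i : schubert_cond n l a -> (1 <= i <= l)%N ->
  (1 <= part a i <= n)%N.
Proof.
case/and3P => /eqP sza srt /allP bnd; case: i => [//|i] /=; rewrite -sza => il.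
exact: bnd (mem_nth 0%N il).
Qed.

Lemma codim_sum n l (a : seq nat) : schubert_cond n l a ->
  codim n l a = (l * (n - l))%N%:Z - (\sum_(x <- a) x)%N%:Z
                + (\sum_(i < l) i.+1)%N%:Z.
Proof.
case/and3P => /eqP sza _ _; rewrite /codim sumrB opprB.
have -> : \sum_(1 <= i < l.+1) i%:Z = (\sum_(i < l) i.+1)%N%:Z.
  by rewrite big_add1 big_mkord (big_morph _ PoszD (erefl _)).
have -> : \sum_(1 <= i < l.+1) (part a i)%:Z = (\sum_(x <- a) x)%N%:Z.
  by rewrite big_add1 /= -sza (big_morph _ PoszD (erefl _)) [RHS](big_nth 0%N).
lia.
Qed.

Lemma codim_le n l (a s : seq nat) :
  (forall i, (1 <= i <= l)%N -> (part s i <= part a i)%N) ->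
  codim n l a <= codim n l s.
Proof.
move=> le_sa; rewrite /codim lerD2l lerN2.
by apply: ler_sum_nat => i il; rewrite lerB // lez_nat le_sa.
Qed.

(** The codimensions differ by a sum of nonnegative differences of entries. The lemma shows that a
    smaller Schubert cell has strictly larger codimension. *)
Lemma codim_inj n l (a s : seq nat) : size a = l -> size s = l ->
  (forall i, (1 <= i <= l)%N -> (part s i <= part a i)%N) ->
  codim n l s <= codim n l a -> s = a.
Proof.
move=> sza szs le_sa; rewrite /codim lerD2l lerN2 -subr_le0 -sumrB => le0.
have ge0 i : (1 <= i < l.+1)%N && true ->
    0 <= ((part a i)%:Z - i%:Z) - ((part s i)%:Z - i%:Z).
  by rewrite andbT ltnS => il; rewrite opprB addrA subrK subr_ge0 lez_nat le_sa.
have /eqP : \sum_(1 <= i < l.+1) (((part a i)%:Z - i%:Z) - ((part s i)%:Z - i%:Z)) = 0.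
  by apply/le_anti; rewrite le0 big_nat_cond sumr_ge0.
rewrite big_nat_cond psumr_eq0 // => /allP eq0.
apply: (@eq_from_nth _ 0%N); rewrite ?szs ?sza // => i il.
have : i.+1 \in index_iota 1 l.+1 by rewrite mem_index_iota.
move=> /eq0; rewrite !ltnS il /= opprB addrA subrK subr_eq0 => /eqP[].
by rewrite /part.
Qed.

Section Subsets.
Variable n : nat.
Implicit Types a : {set 'I_n}.

Definition seq_of_set a : seq nat := [seq (nat_of_ord i).+1 | i <- enum a].

Definition set_of_seq (s : seq nat) : {set 'I_n} := [set i : 'I_n | i.+1 \in s].

Lemma seq_of_set_cond a : schubert_cond n #|a| (seq_of_set a).
Proof.
apply/and3P; split; first by rewrite size_map -cardE.
  rewrite sorted_map /enum_mem -enumT; apply: sorted_filter => [x y z|].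
    exact: ltn_trans.
  have : sorted ltn (map val (enum 'I_n)).
    by rewrite val_enum_ord iota_ltn_sorted.
  by rewrite sorted_map.
apply/allP => x /mapP[i _ ->]; exact: ltn_ord.
Qed.

Lemma seq_of_setK : cancel seq_of_set set_of_seq.
Proof.
move=> a; apply/setP => i; rewrite inE mem_map ?mem_enum //.
by move=> j k [] /val_inj.
Qed.

Lemma cnt_seq_of_set a u : cnt (seq_of_set a) u = #|[pred i in a | (i < u)%N]|.
Proof.
rewrite /cnt count_map cardE -size_filter -filter_predI.
by congr size; apply: eq_filter => i; rewrite !inE andbC.
Qed.

Lemma set_of_seqK (s : seq nat) l : schubert_cond n l s ->
  seq_of_set (set_of_seq s) = s.
Proof.
case/and3P => _ srt /allP bnd; have /and3P[_ srt' _] := seq_of_set_cond (set_of_seq s).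
apply: (irr_sorted_eq ltn_trans ltnn srt' srt) => x.
apply/mapP/idP => [|xs]; first by case=> i; rewrite mem_enum inE => iS ->.
have /andP[x1 xn] := bnd x xs.
have xn' : (x.-1 < n)%N by rewrite prednK.
by exists (Ordinal xn'); rewrite ?mem_enum ?inE /= prednK.
Qed.

(** The positions where the matrix [b] of [greedy_basis] may be nonzero; their number is the
    dimension of the Schubert cell. *)
Definition inversions a : {pred 'I_n * 'I_n} :=
  [pred p | [&& p.1 \in a, p.2 \notin a & (p.2 < p.1)%N]].

(** Each [i] in [a] takes part in [i] minus as many inversions as [a] has elements below [i]; these
    corrections run through [0, ..., #|a| - 1]. *)
Lemma card_inversions a :
  #|inversions a|%:Z = (#|a| * (n - #|a|))%N%:Z - codim n #|a| (seq_of_set a).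
Proof.
rewrite (codim_sum (seq_of_set_cond a)).
have sumS : (\sum_(x <- seq_of_set a) x = \sum_(i in a) i.+1)%N.
  by rewrite big_map big_enum_cond; apply: eq_bigl => i; rewrite andbT.
have sum_cnt : (\sum_(i in a) cnt (seq_of_set a) i = \sum_(i < #|a|) i)%N.
  have -> : (\sum_(i in a) cnt (seq_of_set a) i =
             \sum_(x <- seq_of_set a) cnt (seq_of_set a) x.-1)%N.
    by rewrite big_map big_enum_cond; apply: eq_bigl => i; rewrite andbT.
  have /and3P[/eqP sz _ _] := seq_of_set_cond a.
  rewrite (big_nth 0%N) sz big_mkord; apply: eq_bigr => i _.
  have il : (1 <= i.+1 <= #|a|)%N by rewrite ltn_ord.
  by have [_] := cnt_part (seq_of_set_cond a) il.
have card_inv : (#|inversions a| + \sum_(i < #|a|) i = \sum_(i in a) i)%N.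
  rewrite -sum_cnt -sum1_card.
  rewrite (eq_bigl (fun p : 'I_n * 'I_n => (p.1 \in a) &&
    ((p.2 \notin a) && (p.2 < p.1)%N))) //.
  rewrite -(pair_big_dep (mem a) (fun i j : 'I_n => (j \notin a) && (j < i)%N)
    (fun _ _ => 1%N)) -big_split /=.
  apply: eq_bigr => i _; rewrite cnt_seq_of_set -sum1_card.
  rewrite -[RHS](card_ltn_ord (ltnW (ltn_ord i))) -sum1_card.
  rewrite [RHS](bigID (mem a)) /= addnC.
  by congr (_ + _)%N; apply: eq_bigl => j; rewrite !inE andbC.
have -> : (\sum_(i < #|a|) i.+1 = \sum_(i < #|a|) i + #|a|)%N.
  under eq_bigr do rewrite -addn1; rewrite big_split /=; congr (_ + _)%N.
  by rewrite sum1_card card_ord.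
rewrite sumS; have -> : (\sum_(i in a) i.+1 = \sum_(i in a) i + #|a|)%N.
  under eq_bigr do rewrite -addn1; by rewrite big_split /= sum1_card.
rewrite -card_inv.
move: (\sum_(i < #|a|) i)%N #|inversions a| (#|a| * _)%N => x y z; lia.
Qed.

End Subsets.

(** * The incidence variety *)

Section Selection.
Variables (K : fieldType) (n : nat).

(** Its rows are the unit vectors of the indices in [X]: multiplying by it on the left selects rows,
    by its transpose on the right selects columns. The size [m] is separate from [#|X|] so that
    sizes like [p1 + p2] fit block matrices. *)
Definition selmx (X : {set 'I_n}) m (e : #|X| = m) : 'M[K]_(m, n) :=
  \matrix_(k, j) (enum_val (cast_ord (esym e) k) == j)%:R.

Variables (X : {set 'I_n}) (m : nat) (e : #|X| = m).

Lemma selmx_out i j : j \notin X -> selmx e i j = 0.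
Proof. by move=> jX; rewrite mxE; case: eqP jX => // <-; rewrite enum_valP. Qed.

Lemma selmxK : selmx e *m (selmx e)^T = 1%:M.
Proof.
apply/matrixP => i k; rewrite !mxE (bigD1 (enum_val (cast_ord (esym e) i))) //=.
rewrite !mxE eqxx mul1r big1 ?addr0 => [|j /negPf ne].
  by rewrite (inj_eq enum_val_inj) (inj_eq (@cast_ord_inj _ _ _)) eq_sym.
by rewrite !mxE eq_sym ne mul0r.
Qed.

Lemma mul_selmxE p (A : 'M[K]_(p, n)) i j :
  (A *m (selmx e)^T *m selmx e) i j = if j \in X then A i j else 0.
Proof.
rewrite mxE; case: ifPn => jX; last first.
  by rewrite big1 // => k _; rewrite selmx_out // mulr0.
pose k := cast_ord e (enum_rank_in jX j).
have kE : enum_val (cast_ord (esym e) k) = j by rewrite cast_ordK enum_rankK_in.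
rewrite (bigD1 k) //= [X in _ + X]big1 ?addr0 => [|k' ne].
  rewrite [selmx e k j]mxE kE eqxx mulr1 mxE (bigD1 j) //= !mxE kE eqxx mulr1.
  by rewrite big1 ?addr0 // => j' ne; rewrite !mxE kE eq_sym (negPf ne) mulr0.
rewrite [selmx e k' j]mxE -kE (inj_eq enum_val_inj).
by rewrite (inj_eq (@cast_ord_inj _ _ _)) (negPf ne) mulr0.
Qed.

Lemma mul_selmx p (A : 'M[K]_(p, n)) :
  (forall i j, j \notin X -> A i j = 0) -> A *m (selmx e)^T *m selmx e = A.
Proof.
by move=> AX; apply/matrixP => i j; rewrite mul_selmxE; case: ifPn => // /AX ->.
Qed.

Lemma mul_tr_selmx_eq0 p (A : 'M[K]_(p, n)) i j :
  A *m (selmx e)^T = 0 -> j \in X -> A i j = 0.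
Proof. by move=> A0 jX; have := mul_selmxE A i j; rewrite A0 mul0mx mxE jX. Qed.

Lemma selmx_sub p (A : 'M[K]_(p, n)) :
  (forall i j, j \notin X -> A i j = 0) -> (A <= selmx e)%MS.
Proof. by move=> /mul_selmx <-; rewrite submxMl. Qed.

Lemma rank_selmx : \rank (selmx e) = m.
Proof.
apply/eqP; rewrite eqn_leq rank_leq_row -{1}(mxrank1 K m) -selmxK.
exact: mxrankM_maxl.
Qed.

End Selection.

Section Chart.
Variables (K : fieldType) (n : nat).

Definition supported_on (a : {set 'I_n}) (b : 'M[K]_n) :=
  forall i j, b i j != 0 -> (i \in a) && (j \notin a).

(** [b] lives in the block of rows in [a] and columns outside [a], hence [b^2 = 0]. *)
Lemma supported_unipotent a b : supported_on a b ->
  (1%:M + b) *m (1%:M - b) = 1%:M /\ (1%:M - b) *m (1%:M + b) = 1%:M.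
Proof.
move=> bP; have b2 : b *m b = 0.
  apply/matrixP => i j; rewrite !mxE big1 // => k _.
  have [->|/bP/andP[_ ka]] := eqVneq (b i k) 0; first by rewrite mul0r.
  have [->|/bP/andP[ka' _]] := eqVneq (b k j) 0; first by rewrite mulr0.
  by rewrite ka' in ka.
rewrite mulmxDl mulmxBl !mulmxBr !mulmxDr !mul1mx !mulmx1 b2; split.
  by rewrite subr0 subrK.
by rewrite addr0 addrK.
Qed.

(** [greedy_basis] for the identity frame: [H] is spanned by the rows in [a] of [1 - b], and [1 + b]
    carries it to the coordinate subspace of [a]. There are finitely many charts, so bad sets can be
    bounded chart by chart. *)
Lemma subspace_chart l (H : {vspace 'rV[K]_n}) : \dim H = l ->
  exists (a : {set 'I_n}) (b : 'M[K]_n), [/\ #|a| = l, supported_on a b &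
    forall x, x \in H <-> (forall j, j \notin a -> (x *m (1%:M + b)) 0 j = 0)].
Proof.
move=> dimH; have u1 : 1%:M \in @unitmx K n by apply: unitmx1.
have [a [b [bP bH ba]]] := greedy_basis H u1.
have al : #|a| = l.
  have := ba n; rewrite rows_span_fullv // capvf dimH => <-.
  by apply: eq_card => i; rewrite !inE ltn_ord andbT.
have bS : supported_on a b by move=> i j /bP[-> ->].
have [b1 b2] := supported_unipotent bS.
have HE : rows_span (selmx K al *m (1%:M - b)) l = H.
  apply/eqP; rewrite eqEdim dim_rows_span; last first.
    rewrite /row_free mxrankMfree ?rank_selmx // row_free_unit.
    by case/mulmx1_unit: b2.
  rewrite minnn dimH leqnn andbT; apply/subvP => x /mem_rows_span[y _ ->].
  rewrite mulmxA mulmx_sum_row rpred_sum // => i _.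
  have [ia|ia] := boolP (i \in a).
    by apply: rpredZ; have := bH i ia; rewrite mulmx1.
  rewrite [_ 0 i](_ : _ = 0) ?scale0r ?rpred0 //.
  by rewrite mxE big1 // => k _; rewrite selmx_out // mulr0.
exists a, b; split=> // x; split.
  rewrite -HE => /mem_rows_span[y _ ->] j ja.
  rewrite -!mulmxA b2 mulmx1 mxE.
  by rewrite big1 // => k _; rewrite selmx_out // mulr0.
move=> xa; rewrite -HE; apply/mem_rows_span.
exists (x *m (1%:M + b) *m (selmx K al)^T).
  by move=> i; rewrite leqNgt ltn_ord.
rewrite mulmxA mul_selmx; last by move=> i j ja; rewrite ord1 xa.
by rewrite -mulmxA b1 mulmx1.
Qed.

End Chart.

Lemma card_triples (s n : nat) (P : 'I_s -> pred ('I_n * 'I_n)) :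
  #|[pred t : 'I_s * 'I_n * 'I_n | P t.1.1 (t.1.2, t.2)]|
  = (\sum_r #|P r|)%N.
Proof.
rewrite -sum1_card big_mkcond /=.
rewrite -(pair_bigA _ (fun (q : 'I_s * 'I_n) j => if P q.1 (q.2, j) then 1%N else 0%N)).
rewrite -(pair_bigA _ (fun r i => \sum_j if P r (i, j) then 1%N else 0%N)) /=.
apply: eq_bigr => r _; rewrite pair_bigA -sum1_card big_mkcond /=.
by rewrite [RHS]big_mkcond; apply: eq_bigr => -[i j] _.
Qed.

Section Incidence.
Variables (K : fieldType) (n l s : nat).
Variables (a0 : {set 'I_n}) (a : 'I_s -> {set 'I_n}).
Hypotheses (card_a0 : #|a0| = l) (card_a : forall r, #|a r| = l).

Definition chart_pos : {pred 'I_n * 'I_n} :=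
  [pred p | (p.1 \in a0) && (p.2 \notin a0)].
(** The free entries of [D = (1 - b) Phi (1 + b0)]. The rows of [(1 - b) Phi] with index in [a r]
    lie in [H], so in the chart they have no entries outside [a0]. *)
Definition frame_pos (r : 'I_s) : {pred 'I_n * 'I_n} :=
  [pred p | ~~ ((p.1 \in a r) && (p.2 \notin a0))].

Definition chart_vars : finType := {p : 'I_n * 'I_n | chart_pos p}.
Definition flag_vars : finType :=
  {t : 'I_s * 'I_n * 'I_n | inversions (a t.1.1) (t.1.2, t.2)}.
Definition frame_vars : finType :=
  {t : 'I_s * 'I_n * 'I_n | frame_pos t.1.1 (t.1.2, t.2)}.
Definition incidence_vars : finType := (chart_vars + flag_vars + frame_vars)%type.

(** Flag [r] contributes its inversions, [l(n - l)] minus the codimension, and the [n^2 - l(n - l)]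
    free entries of [D_r]; the chart contributes [l(n - l)]. *)
Lemma card_incidence_vars :
  #|incidence_vars|%:Z = #|{: 'I_s * 'I_n * 'I_n}|%:Z + (l * (n - l))%N%:Z
                         - \sum_r codim n l (seq_of_set (a r)).
Proof.
have card_setX (b : {set 'I_n}) : #|b| = l ->
    #|[pred p : 'I_n * 'I_n | (p.1 \in b) && (p.2 \notin a0)]| = (l * (n - l))%N.
  move=> bl; have := cardX (mem b) (mem (~: a0)).
  rewrite bl cardsCs finset.setCK card_a0 card_ord => <-.
  by apply: eq_card => p; rewrite !inE.
have chartE : #|chart_vars| = (l * (n - l))%N.
  by rewrite card_sig -(card_setX a0).
have flagE : #|flag_vars| = (\sum_r #|inversions (a r)|)%N.
  by rewrite card_sig -card_triples.
have frameE : (#|frame_vars| + s * (l * (n - l)) = #|{: 'I_s * 'I_n * 'I_n}|)%N.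
  pose P (r : 'I_s) : {pred 'I_n * 'I_n} := [pred p | (p.1 \in a r) && (p.2 \notin a0)].
  rewrite card_sig -(cardC [pred t : 'I_s * 'I_n * 'I_n | frame_pos t.1.1 (t.1.2, t.2)]).
  congr (_ + _)%N; transitivity (\sum_r #|P r|)%N.
    rewrite (eq_bigr (fun=> l * (n - l)))%N ?sum_nat_const ?card_ord //.
    by move=> r _; apply: card_setX.
  by rewrite -card_triples; apply: eq_card => t; rewrite !inE negbK.
have codimE : \sum_r codim n l (seq_of_set (a r)) =
    (s * (l * (n - l)))%N%:Z - (\sum_r #|inversions (a r)|)%N%:Z.
  have -> : (s * (l * (n - l)) = \sum_(r < s) l * (n - l))%N.
    by rewrite sum_nat_const card_ord.
  rewrite !(big_morph _ PoszD (erefl _)) -sumrB; apply: eq_bigr => r _.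
  by rewrite card_inversions card_a; lia.
rewrite codimE !card_sum chartE flagE -frameE.
move: #|frame_vars| (\sum_r _)%N (l * (n - l))%N (s * _)%N => x y z t; lia.
Qed.

Definition chartmx (x : incidence_vars -> K) : 'M[K]_n :=
  \matrix_(i, j) oapp (fun p => x (inl (inl p))) 0 (insub (i, j)).
Definition flagmx (x : incidence_vars -> K) (r : 'I_s) : 'M[K]_n :=
  \matrix_(i, j) oapp (fun p => x (inl (inr p))) 0 (insub (r, i, j)).
Definition framemx (x : incidence_vars -> K) (r : 'I_s) : 'M[K]_n :=
  \matrix_(i, j) oapp (fun p => x (inr p)) 0 (insub (r, i, j)).

Definition incidence (x : incidence_vars -> K) (t : 'I_s * 'I_n * 'I_n) : K :=
  ((1%:M + flagmx x t.1.1) *m framemx x t.1.1 *m (1%:M - chartmx x)) t.1.2 t.2.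

Lemma incidence_params (b0 : 'M[K]_n) (b D : 'I_s -> 'M[K]_n) :
  (forall i j, ~~ chart_pos (i, j) -> b0 i j = 0) ->
  (forall r i j, ~~ inversions (a r) (i, j) -> b r i j = 0) ->
  (forall r i j, ~~ frame_pos r (i, j) -> D r i j = 0) ->
  exists x, [/\ chartmx x = b0, flagmx x =1 b & framemx x =1 D].
Proof.
move=> b0P bP DP.
exists (fun v => match v with
  | inl (inl p) => b0 (val p).1 (val p).2
  | inl (inr t) => b (val t).1.1 (val t).1.2 (val t).2
  | inr t => D (val t).1.1 (val t).1.2 (val t).2 end).
by split=> [|r|r]; apply/matrixP => i j; rewrite mxE;
  case: insubP => [p _ /= -> //|/= out]; rewrite ?b0P ?bP ?DP.
Qed.

Lemma polyfun_oapp (S T : finType) (P : pred S) (inj : {z | P z} -> T) (o : option {z | P z}) :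
  polyfun (fun x : T -> K => oapp (fun p => x (inj p)) 0 o).
Proof. by case: o => [p|]; [apply: polyfunX|apply: polyfunC]. Qed.

Lemma polyfun_framemx r i j : polyfun (fun x => framemx x r i j).
Proof.
by apply: polyfun_ext (polyfun_oapp (fun p => inr p) (insub (r, i, j))) => x; rewrite mxE.
Qed.

Lemma polyfun_incidence t : polyfun (fun x => incidence x t).
Proof.
apply: polyfun_mulmx => [i j|i j].
  apply: polyfun_mulmx => [i' j'|]; last exact: polyfun_framemx.
  apply: (@polyfun_ext _ _ (fun x => 1%:M i' j' + flagmx x t.1.1 i' j')) => [x|].
    by rewrite [RHS]mxE.
  apply: polyfunD (polyfunC _ _) _.
  by apply: polyfun_ext (polyfun_oapp (fun p => inl (inr p)) (insub (t.1.1, i', j')));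
    move=> x; rewrite mxE.
apply: (@polyfun_ext _ _ (fun x => 1%:M i j + (- 1) * chartmx x i j)) => [x|].
  by rewrite mulN1r [RHS]mxE [X in _ = _ + X]mxE.
apply: polyfunD (polyfunC _ _) (polyfunM (polyfunC _ _) _).
by apply: polyfun_ext (polyfun_oapp (fun p => inl (inl p)) (insub (i, j)));
  move=> x; rewrite mxE.
Qed.

Definition minormx (D D' : 'M[K]_n) (X1 X2 X0 : {set 'I_n}) p1 p2
    (e1 : #|X1| = p1) (e2 : #|X2| = p2) (e0 : #|X0| = (p1 + p2)%N) :
    'M[K]_(p1 + p2) :=
  col_mx (selmx K e1 *m D) (selmx K e2 *m D') *m (selmx K e0)^T.

(** A witness that the mixed minor is not identically zero: [D] and [D'] carry the upper and the
    lower part of an identity matrix. *)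
Lemma minormx_det1 (X1 X2 X0 : {set 'I_n}) p1 p2
    (e1 : #|X1| = p1) (e2 : #|X2| = p2) (e0 : #|X0| = (p1 + p2)%N) :
  minormx ((selmx K e1)^T *m usubmx (selmx K e0))
          ((selmx K e2)^T *m dsubmx (selmx K e0)) e1 e2 e0 = 1%:M.
Proof. by rewrite /minormx !mulmxA !selmxK !mul1mx vsubmxK selmxK. Qed.

(** As [r] and [r'] differ, their matrices can be set independently to the witness of
    [minormx_det1], which only uses free positions. So the determinant is nonzero at some parameter
    point and [small_image] applies. *)
Lemma incidence_minor_small (r r' : 'I_s) (X1 X2 X0 : {set 'I_n}) p1 p2
    (e1 : #|X1| = p1) (e2 : #|X2| = p2) (e0 : #|X0| = (p1 + p2)%N) :
  r != r' ->
  {in X1 & X0, forall i j, frame_pos r (i, j)} ->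
  {in X2 & X0, forall i j, frame_pos r' (i, j)} ->
  (#|incidence_vars| <= #|{: 'I_s * 'I_n * 'I_n}|)%N ->
  small (fun y => exists2 x,
    \det (minormx (framemx x r) (framemx x r') e1 e2 e0) = 0 & y =1 incidence x).
Proof.
move=> rr' pos1 pos2 leT.
pose D1 := (selmx K e1)^T *m usubmx (selmx K e0).
pose D2 := (selmx K e2)^T *m dsubmx (selmx K e0).
have out1 i j : ~~ frame_pos r (i, j) -> D1 i j = 0.
  move=> out; rewrite mxE big1 // => k _.
  rewrite [_^T i k]mxE [usubmx _ _ _]mxE.
  have [iX|iX] := boolP (i \in X1); last by rewrite selmx_out ?mul0r.
  have [jX|jX] := boolP (j \in X0); last by rewrite [X in _ * X]selmx_out ?mulr0.
  by rewrite pos1 in out.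
have out2 i j : ~~ frame_pos r' (i, j) -> D2 i j = 0.
  move=> out; rewrite mxE big1 // => k _.
  rewrite [_^T i k]mxE [dsubmx _ _ _]mxE.
  have [iX|iX] := boolP (i \in X2); last by rewrite selmx_out ?mul0r.
  have [jX|jX] := boolP (j \in X0); last by rewrite [X in _ * X]selmx_out ?mulr0.
  by rewrite pos2 in out.
pose D q := if q == r then D1 else if q == r' then D2 else 0.
have [x0 [_ _ x0D]] : exists x,
    [/\ chartmx x = 0, flagmx x =1 (fun=> 0) & framemx x =1 D].
  apply: incidence_params => [i j _|q i j _|q i j]; rewrite ?mxE // /D.
  have [->|_] := eqVneq q r; first exact: out1.
  have [->|_] := eqVneq q r'; first exact: out2.
  by rewrite mxE.
apply: (@small_image _ _ _ _ _ x0) => //.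
- exact: polyfun_incidence.
- apply: polyfun_det; apply: polyfun_mulmx => i j; last exact: polyfunC.
  apply: (@polyfun_ext _ _ (fun x => match fintype.split i with
    | inl k => (selmx K e1 *m framemx x r) k j
    | inr k => (selmx K e2 *m framemx x r') k j end)) => [x|].
    by rewrite mxE; case: (fintype.split i).
  case: (fintype.split i) => k; apply: polyfun_mulmx => i' j'; try exact: polyfunC;
    exact: polyfun_framemx.
- by rewrite !x0D /D !eqxx [r' == r]eq_sym (negPf rr') minormx_det1 det1 oner_neq0.
Qed.

End Incidence.

(** * Nonzero minors imply transversality *)

Section Transversality.
Variables (K : fieldType) (n l : nat).
Variables (a0 : {set 'I_n}) (b0 : 'M[K]_n) (H : {vspace 'rV[K]_n}).
Hypotheses (card_a0 : #|a0| = l) (b0P : supported_on a0 b0).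
Hypothesis HP : forall x, x \in H <->
  (forall j, j \notin a0 -> (x *m (1%:M + b0)) 0 j = 0).

Definition frame_of (a : {set 'I_n}) (b D Phi : 'M[K]_n) : Prop :=
  [/\ #|a| = l, forall i j, b i j != 0 -> [/\ i \in a, j \notin a & (j < i)%N],
      forall i j, i \in a -> j \notin a0 -> D i j = 0, Phi \in unitmx
    & Phi = (1%:M + b) *m D *m (1%:M - b0)].

Definition below (a : {set 'I_n}) (u : nat) : {set 'I_n} :=
  [set i in a | (i < u)%N].

Lemma frame_unit a b D Phi : frame_of a b D Phi -> D \in unitmx.
Proof.
by case=> _ _ _ uPhi PhiE; move: uPhi; rewrite PhiE !unitmx_mul => /andP[/andP[]].
Qed.

(** The invertible [D] maps the coordinate space of [a] into that of [a0]; both have dimension [l],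
    so the former is the full preimage. *)
Lemma frame_supp a b D Phi (w : 'rV[K]_n) : frame_of a b D Phi ->
  (forall j, j \notin a0 -> (w *m D) 0 j = 0) -> forall i, i \notin a -> w 0 i = 0.
Proof.
move=> fr wD i ia; have uD := frame_unit fr; case: fr => al _ D0 _ _.
have frD : row_free D by rewrite row_free_unit.
have sub : (selmx K al *m D <= selmx K card_a0)%MS.
  apply: selmx_sub => k j ja; rewrite mxE big1 // => i' _.
  have [ia'|ia'] := boolP (i' \in a); first by rewrite D0 ?mulr0.
  by rewrite selmx_out ?mul0r.
have /eqmxP eqR : (selmx K al *m D == selmx K card_a0)%MS.
  by rewrite -(mxrank_leqif_eq sub) mxrankMfree // !rank_selmx.
have : (w *m D <= selmx K al *m D)%MS.
  by rewrite eqR; apply: selmx_sub => k j ja; rewrite ord1 wD.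
rewrite submxMfree // => /submxP[c ->].
by rewrite mxE big1 // => k _; rewrite selmx_out // mulr0.
Qed.

(** [1 + b] is lower triangular, so it keeps coordinates below [u] below [u]; [frame_supp] confines
    them to [a]. *)
Lemma frame_coords a b D Phi u (x : 'rV[K]_n) : frame_of a b D Phi ->
  x \in H -> x \in rows_span Phi u ->
  exists2 w : 'rV[K]_n, x *m (1%:M + b0) = w *m D &
    forall i, i \notin below a u -> w 0 i = 0.
Proof.
move=> fr xH /mem_rows_span[y yu xE].
have [b1 b2] := supported_unipotent b0P.
have [_ bP _ _ PhiE] := fr.
have wE : x *m (1%:M + b0) = y *m (1%:M + b) *m D.
  by rewrite xE PhiE -!mulmxA b2 mulmx1.
exists (y *m (1%:M + b)) => // i; rewrite inE negb_and => /orP[ia|].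
  by apply: (frame_supp fr) ia => j ja; rewrite -wE; apply: (HP x).1 ja.
rewrite -leqNgt => ui; rewrite mulmxDr mulmx1 mxE yu // add0r mxE big1 // => k _.
have [->|/bP[_ _ ik]] := eqVneq (b k i) 0; first by rewrite mulr0.
by rewrite yu ?mul0r // (leq_trans ui) // ltnW.
Qed.

Lemma frame_mem_span a b D Phi u p (e : #|below (~: a) u| = p) (t : 'rV[K]_p) :
  frame_of a b D Phi ->
  t *m (selmx K e *m D) *m (1%:M - b0) \in rows_span Phi u.
Proof.
move=> [_ bP _ _ PhiE].
have bS : supported_on a b by move=> i j /bP[-> ->].
have [_ b2] := supported_unipotent bS.
apply/mem_rows_span; exists (t *m selmx K e *m (1%:M - b)); last first.
  by rewrite PhiE !mulmxA -[_ *m (1%:M - b) *m _]mulmxA b2 mulmx1.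
have tout (j : 'I_n) : (u <= j)%N -> (t *m selmx K e) 0 j = 0.
  move=> uj; rewrite mxE big1 // => k _; rewrite selmx_out ?mulr0 //.
  by rewrite !inE negb_and -leqNgt uj orbT.
move=> i ui; rewrite mulmxBr mulmx1 mxE tout // mxE add0r mxE big1 ?oppr0 // => k _.
have [->|/bP[_ _ ik]] := eqVneq (b k i) 0; first by rewrite mulr0.
by rewrite tout ?mul0r // (leq_trans ui) // ltnW.
Qed.

Variables (a a' : {set 'I_n}) (b D Phi b' D' Phi' : 'M[K]_n) (u v p1 p2 : nat).
Hypotheses (fr : frame_of a b D Phi) (fr' : frame_of a' b' D' Phi').

(** A common vector has coordinates [w] and [w'] in the two frames with [w D = w' D'], so [w] and
    [-w'] together form a left kernel vector of the minor. *)
Lemma transversal_cap (e1 : #|below a u| = p1) (e2 : #|below a' v| = p2)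
    (e0 : #|a0| = (p1 + p2)%N) :
  \det (minormx D D' e1 e2 e0) != 0 ->
  (H :&: rows_span Phi u :&: rows_span Phi' v = 0)%VS.
Proof.
move=> detW; have uW : minormx D D' e1 e2 e0 \in unitmx by rewrite unitmxE unitfE.
have [b1 _] := supported_unipotent b0P.
apply/eqP; rewrite -subv0; apply/subvP => x; rewrite !memv_cap memv0.
case/andP => /andP[xH xu] xv.
have [w wE wu] := frame_coords fr xH xu.
have [w' wE' wv] := frame_coords fr' xH xv.
have wR : w *m (selmx K e1)^T *m selmx K e1 = w.
  by apply: mul_selmx => i j; rewrite ord1; apply: wu.
have wR' : w' *m (selmx K e2)^T *m selmx K e2 = w'.
  by apply: mul_selmx => i j; rewrite ord1; apply: wv.
have : row_mx (w *m (selmx K e1)^T) (- (w' *m (selmx K e2)^T)) *m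
    minormx D D' e1 e2 e0 = 0.
  rewrite /minormx mulmxA mul_row_col mulNmx !mulmxA wR wR' -wE -wE' subrr.
  exact: mul0mx.
move/(congr1 (mulmx^~ (invmx (minormx D D' e1 e2 e0)))); rewrite mulmxK // mul0mx.
rewrite -[0]row_mx0 => /eq_row_mx[w0 _].
by rewrite -[x]mulmx1 -b1 mulmxA wE -wR w0 !mul0mx.
Qed.

(** Inverting the minor yields combinations of rows of [D] and [D'] that agree with a given vector,
    in the chart, on all columns outside [a0]; what remains lies in [H]. *)
Lemma transversal_sum (e1 : #|below (~: a) u| = p1)
    (e2 : #|below (~: a') v| = p2) (e0 : #|~: a0| = (p1 + p2)%N) :
  \det (minormx D D' e1 e2 e0) != 0 ->
  (H + rows_span Phi u + rows_span Phi' v)%VS = fullv.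
Proof.
move=> detW; have uW : minormx D D' e1 e2 e0 \in unitmx by rewrite unitmxE unitfE.
have [b1 b2] := supported_unipotent b0P.
apply/eqP; rewrite eqEsubv subvf; apply/subvP => x _.
pose z := x *m (1%:M + b0).
pose t := z *m (selmx K e0)^T *m invmx (minormx D D' e1 e2 e0).
pose z1 := lsubmx t *m (selmx K e1 *m D); pose z2 := rsubmx t *m (selmx K e2 *m D').
have zE : (z - (z1 + z2)) *m (selmx K e0)^T = 0.
  apply/eqP; rewrite mulmxBl subr_eq0 /z1 /z2 -mul_row_col hsubmxK eq_sym.
  apply/eqP; rewrite -[RHS](mulmxKV uW) -/t /minormx mulmxA //.
have -> : x = (z - (z1 + z2)) *m (1%:M - b0) + z1 *m (1%:M - b0) + z2 *m (1%:M - b0).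
  by rewrite -!mulmxDl -addrA subrK -mulmxA b1 mulmx1.
apply: memv_add; last exact: frame_mem_span fr'.
apply: memv_add; last exact: frame_mem_span fr.
apply/HP => j ja; rewrite -mulmxA b2 mulmx1.
by apply: mul_tr_selmx_eq0 zE _; rewrite inE.
Qed.

End Transversality.

Lemma card_below (n l : nat) (s : seq nat) u : schubert_cond n l s ->
  #|below (set_of_seq n s) u| = cnt s u.
Proof. by move=> sP; rewrite cardsE -cnt_seq_of_set (set_of_seqK sP). Qed.

Lemma card_belowC (n : nat) (a : {set 'I_n}) u : (u <= n)%N ->
  (#|below a u| + #|below (~: a) u| = u)%N.
Proof.
move=> un; rewrite -[RHS](card_ltn_ord un) -[RHS](cardID (mem a)) !cardsE.
congr (_ + _)%N; apply: eq_card => i; rewrite !inE /= unfold_in /=.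
  by rewrite andbC.
by rewrite inE.
Qed.

Lemma small0 (K : fieldType) (I : finType) : @small K I (fun=> False).
Proof. by exists 1; rewrite ?oner_neq0. Qed.

(** * Tuples of flags in bad position form a small set *)

Section GenericPosition.
Variables (K : fieldType) (n l : nat).

(* In its open Schubert cell H meets F_u in dimension cnt al u; hence the two
   conditions say that subspaces of complementary dimension, in H and in the
   quotient of the whole space by H, are transversal. *)
Definition general_position (al be : seq nat) (F F' : nat -> {vspace 'rV[K]_n})
    (H : {vspace 'rV[K]_n}) : Prop :=
  forall u v, (u <= n)%N -> (v <= n)%N ->
  ((cnt al u + cnt be v)%N = l -> (H :&: F u :&: F' v = 0)%VS) /\
  ((u + v)%N = (n - l + cnt al u + cnt be v)%N -> (H + F u + F' v)%VS = fullv).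

Variables (s : nat) (al : 'I_s -> seq nat).
Hypotheses (ln : (l <= n)%N) (al_cond : forall r, schubert_cond n l (al r)).
Hypothesis al_codim : \sum_r codim n l (al r) = (l * (n - l))%N%:Z.

(** [a] is the actual relative position of [H] and the flag, which may be more special than the
    condition [al r] demands. *)
Lemma schubert_frame (Phi : 'M[K]_n) (H : {vspace 'rV[K]_n}) (a0 : {set 'I_n}) b0 r :
  #|a0| = l -> supported_on a0 b0 ->
  (forall x, x \in H <-> (forall j, j \notin a0 -> (x *m (1%:M + b0)) 0 j = 0)) ->
  Phi \in unitmx -> schubert_variety l (al r) (rows_span Phi) H ->
  exists (a : {set 'I_n}) (bD : 'M[K]_n * 'M[K]_n),
    frame_of l a0 b0 a bD.1 bD.2 Phi /\
    (forall i, (1 <= i <= l)%N -> (part (seq_of_set a) i <= part (al r) i)%N).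
Proof.
move=> card_a0 b0P HP uPhi [dimH dimHF].
have [b1 b2] := supported_unipotent b0P.
have [a [b [bP bH ba]]] := greedy_basis H uPhi.
have card_a : #|a| = l.
  have := ba n; rewrite rows_span_fullv // capvf dimH => <-.
  by apply: eq_card => i; rewrite !inE ltn_ord andbT.
have bS : supported_on a b by move=> i j /bP[-> ->].
have [b3 b4] := supported_unipotent bS.
exists a, (b, (1%:M - b) *m Phi *m (1%:M + b0)); split.
  split=> //=; last by rewrite !mulmxA b3 mul1mx -mulmxA b1 mulmx1.
  move=> i j ia ja; have /HP/(_ j ja) := bH i ia.
  by rewrite -row_mul mxE.
have /and3P[/eqP sz srt _] := seq_of_set_cond a.
case=> [//|i] /andP[_ il]; rewrite /part nth_leq_cnt ?sz ?card_a //.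
by rewrite cnt_seq_of_set ba; apply: dimHF.
Qed.

Lemma frames_incidence (a0 : {set 'I_n}) b0 (a : 'I_s -> {set 'I_n})
    (bD : 'I_s -> 'M[K]_n * 'M[K]_n) (Phi : 'I_s -> 'M[K]_n)
    (y : 'I_s * 'I_n * 'I_n -> K) :
  supported_on a0 b0 ->
  (forall q, frame_of l a0 b0 (a q) (bD q).1 (bD q).2 (Phi q)) ->
  (forall t, y t = Phi t.1.1 t.1.2 t.2) ->
  exists2 x : incidence_vars a0 a -> K,
    forall q, framemx x q = (bD q).2 & y =1 incidence x.
Proof.
move=> b0P fr yE.
have [|||x [x0 x1 x2]] := @incidence_params K n s a0 a b0
    (fun q => (bD q).1) (fun q => (bD q).2).
- by move=> i j; apply: contraNeq => /b0P.
- move=> q i j; apply: contraNeq; have [_ bP _ _ _] := fr q.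
  by case/bP => ia ja ji; rewrite /inversions /= ia ja.
- move=> q i j; rewrite /frame_pos /= negbK => /andP[ia ja].
  by have [_ _ D0 _ _] := fr q; apply: D0.
exists x => [q|t]; first exact: x2.
rewrite yE /incidence x0 x1 x2.
by have [_ _ _ _ <-] := fr t.1.1.
Qed.

Lemma generic_position :
  small (fun y : 'I_s * 'I_n * 'I_n -> K => exists Phi : 'I_s -> 'M[K]_n,
    [/\ forall r, Phi r \in unitmx, forall t, y t = Phi t.1.1 t.1.2 t.2
      & exists (H : {vspace 'rV[K]_n}) (r r' : 'I_s),
        [/\ forall q, schubert_variety l (al q) (rows_span (Phi q)) H, r != r'
          & ~ general_position (al r) (al r') (rows_span (Phi r)) (rows_span (Phi r')) H]]).
Proof.
pose A r := set_of_seq n (al r).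
have AE r : seq_of_set (A r) = al r by apply: set_of_seqK (al_cond r).
have card_A r : #|A r| = l.
  have /and3P[/eqP + _ _] := seq_of_set_cond (A r).
  by have /and3P[/eqP <- _ _] := al_cond r; rewrite AE => <-.
(* Tuples for which some flag meets [H] in a more special position than required. *)
pose special (c : {set 'I_n} * {ffun 'I_s -> {set 'I_n}}) y :=
  [/\ #|c.1| = l, forall r, #|c.2 r| = l,
      forall r i, (1 <= i <= l)%N -> (part (seq_of_set (c.2 r)) i <= part (al r) i)%N,
      exists r, c.2 r != A r & exists x, y =1 incidence (K := K) (a0 := c.1) (a := c.2) x].
(* Tuples in the expected cells with a vanishing minor. The proof [e0] belongs to the data because
   the minor is square only for matching cardinalities; [sumdet] is the same on the complements. *)
pose capdet (c : {set 'I_n} * 'I_s * 'I_s * 'I_n.+1 * 'I_n.+1) y :=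
  let: (a0, r, r', u, v) := c in
  [/\ r != r', #|a0| = l &
  exists (e0 : #|a0| = (#|below (A r) u| + #|below (A r') v|)%N),
  exists2 x : incidence_vars a0 A -> K,
    \det (minormx (framemx x r) (framemx x r') erefl erefl e0) = 0 & y =1 incidence x].
pose sumdet (c : {set 'I_n} * 'I_s * 'I_s * 'I_n.+1 * 'I_n.+1) y :=
  let: (a0, r, r', u, v) := c in
  [/\ r != r', #|a0| = l &
  exists (e0 : #|~: a0| = (#|below (~: A r) u| + #|below (~: A r') v|)%N),
  exists2 x : incidence_vars a0 A -> K,
    \det (minormx (framemx x r) (framemx x r') erefl erefl e0) = 0 & y =1 incidence x].
have small_special : small (fun y => exists c, special c y).
  apply: small_bigU => -[a0 a].
  have [C|nC] := pselect ([/\ #|a0| = l, forall r, #|a r| = l,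
      forall r i, (1 <= i <= l)%N -> (part (seq_of_set (a r)) i <= part (al r) i)%N &
      exists r, a r != A r]); last first.
    by apply: smallS (small0 K _) => y [c1 c2 c3 c4 _]; apply: nC.
  case: C => c1 c2 c3 [r0 c4].
  apply: (@smallS _ _ _ (fun y => exists x, y =1 incidence (K := K) (a0 := a0) (a := a) x)).
    by move=> y [].
  apply: small_image_lt => [|t]; last exact: polyfun_incidence.
  (* One smaller cell pushes the sum of codimensions above [l(n - l)], which leaves fewer parameters
     than frame entries. *)
  rewrite -ltz_nat (card_incidence_vars c1 c2) -al_codim.
  have /and3P[/eqP sz_al _ _] := al_cond r0.
  have /and3P[/eqP sz_a _ _] := seq_of_set_cond (a r0).
  have lt0 : codim n l (al r0) < codim n l (seq_of_set (a r0)).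
    rewrite ltNge; apply: contra c4 => le0.
    rewrite -[a r0]seq_of_setK (codim_inj sz_al _ (c3 r0) le0) ?eqxx //.
    by rewrite sz_a c2.
  have : \sum_r codim n l (al r) < \sum_r codim n l (seq_of_set (a r)).
    rewrite (bigD1 r0) //= [ltRHS](bigD1 r0) //= ltr_leD // ler_sum // => q _.
    exact: codim_le (c3 q).
  by rewrite ltrBlDr ltrD2l.
have cardT (a0 : {set 'I_n}) : #|a0| = l ->
    (#|incidence_vars a0 A| <= #|{: 'I_s * 'I_n * 'I_n}|)%N.
  move=> c0; rewrite -lez_nat (card_incidence_vars c0 card_A) -al_codim.
  by under [X in _ - X]eq_bigr do rewrite AE; rewrite addrK.
have small_capdet : small (fun y => exists c, capdet c y).
  apply: small_bigU => -[[[[a0 r] r'] u] v].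
  have [rr'|rr'] := eqVneq r r'.
    by apply: smallS (small0 K _) => y []; rewrite rr' eqxx.
  have [c0|c0] := eqVneq #|a0| l; last first.
    by apply: smallS (small0 K _) => y [_ /eqP]; rewrite (negPf c0).
  have [e0|ne] := eqVneq #|a0| (#|below (A r) u| + #|below (A r') v|)%N; last first.
    by apply: smallS (small0 K _) => y [_ _ [e _]]; move: ne; rewrite e eqxx.
  apply: smallS (incidence_minor_small K (a := A) (a0 := a0)
    (erefl #|below (A r) u|) (erefl #|below (A r') v|) e0 rr' _ _ (cardT _ c0)).
  - by move=> y [_ _ [e [x xE yx]]]; exists x => //; rewrite -xE (eq_irrelevance e e0).
  (* The minor uses columns in [a0], where no zeros are prescribed; in [sumdet] it uses rows outside
     [A r], which are unrestricted as well. *)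
  - by move=> i j _ ja; rewrite /frame_pos /= ja andbF.
  - by move=> i j _ ja; rewrite /frame_pos /= ja andbF.
have small_sumdet : small (fun y => exists c, sumdet c y).
  apply: small_bigU => -[[[[a0 r] r'] u] v].
  have [rr'|rr'] := eqVneq r r'.
    by apply: smallS (small0 K _) => y []; rewrite rr' eqxx.
  have [c0|c0] := eqVneq #|a0| l; last first.
    by apply: smallS (small0 K _) => y [_ /eqP]; rewrite (negPf c0).
  have [e0|ne] := eqVneq #|~: a0| (#|below (~: A r) u| + #|below (~: A r') v|)%N; last first.
    by apply: smallS (small0 K _) => y [_ _ [e _]]; move: ne; rewrite e eqxx.
  apply: smallS (incidence_minor_small K (a := A) (a0 := a0)
    (erefl #|below (~: A r) u|) (erefl #|below (~: A r') v|) e0 rr' _ _ (cardT _ c0)).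
  - by move=> y [_ _ [e [x xE yx]]]; exists x => //; rewrite -xE (eq_irrelevance e e0).
  - by move=> i j; rewrite /frame_pos !inE /= => /andP[/negPf -> _].
  - by move=> i j; rewrite /frame_pos !inE /= => /andP[/negPf -> _].
apply: smallS (smallU small_special (smallU small_capdet small_sumdet)).
move=> y [Phi [uPhi yE [H [r [r' [HX rr' ntr]]]]]].
have [dimH _] := HX r.
have [a0 [b0 [card_a0 b0P HP]]] := subspace_chart dimH.
have /fin_all_exists[a /fin_all_exists[bD fr]] q := schubert_frame card_a0 b0P HP (uPhi q) (HX q).
have fr1 q := (fr q).1; have fr2 q := (fr q).2.
pose af : {ffun 'I_s -> {set 'I_n}} := [ffun q => a q].
have [aA|aA] := pselect (forall q, a q = A q); last first.
  left; exists (a0, af); split=> //=.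
  - by move=> q; rewrite ffunE; case: (fr1 q).
  - by move=> q i; rewrite ffunE; apply: fr2.
  - apply: contrapT => eqA; apply: aA => q; apply/eqP; apply: contrapT => ne.
    by apply: eqA; exists q; rewrite ffunE; apply/negP.
  have fr3 q : frame_of l a0 b0 (af q) (bD q).1 (bD q).2 (Phi q).
    by rewrite ffunE; apply: fr1.
  by have [x _ yx] := frames_incidence b0P fr3 yE; exists x.
right; have fr3 q : frame_of l a0 b0 (A q) (bD q).1 (bD q).2 (Phi q).
  by rewrite -aA; apply: fr1.
have [x xD yx] := frames_incidence b0P fr3 yE.
apply: contrapT => nsmall; apply: ntr => u v un vn.
have [un1 vn1] : (u < n.+1)%N /\ (v < n.+1)%N by rewrite !ltnS.
split=> uvE.
  have e0 : #|a0| = (#|below (A r) u| + #|below (A r') v|)%N.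
    by rewrite !(card_below _ (al_cond _)) uvE.
  apply: (transversal_cap card_a0 b0P HP (fr3 r) (fr3 r') (e0 := e0)
    (e1 := erefl) (e2 := erefl)).
  apply/eqP => det0; apply: nsmall; left.
  exists (a0, r, r', Ordinal un1, Ordinal vn1); split=> //=.
  by exists e0; exists x => //; rewrite !xD.
have e0 : #|~: a0| = (#|below (~: A r) u| + #|below (~: A r') v|)%N.
  have := card_belowC (A r) un; have := card_belowC (A r') vn.
  have -> : #|~: a0| = (n - l)%N by rewrite cardsCs finset.setCK card_ord card_a0.
  rewrite !(card_below _ (al_cond _)).
  move: uvE ln; lia.
apply: (transversal_sum b0P HP (fr3 r) (fr3 r') (e0 := e0)
  (e1 := erefl) (e2 := erefl)).
apply/eqP => det0; apply: nsmall; right.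
exists (a0, r, r', Ordinal un1, Ordinal vn1); split=> //=.
by exists e0; exists x => //; rewrite !xD.
Qed.

End GenericPosition.

(** * Open dense sets of flags *)

Section FlagFrames.
Variables (K : fieldType) (n : nat).

Lemma rows_span_complete_flag (Phi : 'M[K]_n) :
  Phi \in unitmx -> complete_flag (rows_span Phi).
Proof.
by move=> uPhi; split=> [j|i j]; [apply: dim_rows_span_unit|apply: rows_spanS].
Qed.

Lemma complete_flag_frame (F : nat -> {vspace 'rV[K]_n}) : complete_flag F ->
  exists2 Phi : 'M[K]_n, Phi \in unitmx & rows_span Phi = F.
Proof.
move=> [dimF subF].
have /fin_all_exists2[v vF vN] (i : 'I_n) : exists2 v, v \in F i.+1 & v \notin F i.
  apply/subvPn; apply/negP => /dimvS; rewrite !dimF.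
  by have := ltn_ord i; lia.
pose Phi := \matrix_i v i.
have sub j : (rows_span Phi j <= F j)%VS.
  apply/subvP => x /mem_rows_span[y yj ->].
  rewrite mulmx_sum_row rpred_sum // => i _; have [ij|/yj ->] := ltnP i j.
    by rewrite rowK rpredZ // (subvP (subF _ _ ij)).
  by rewrite scale0r rpred0.
have dimR j : (j <= n)%N -> \dim (rows_span Phi j) = j.
  elim: j => [_|j IHj jn].
    by apply/eqP; rewrite -leqn0 (leq_trans (dimvS (sub 0%N))) // dimF min0n.
  rewrite rows_spanE; under eq_bigl do rewrite -[(_ < _)%N]andbT.
  rewrite (big_ltn_ord_recr _ xpredT _ jn) /=.
  under eq_bigl do rewrite andbT; rewrite -rows_spanE addv_line_dim IHj 1?ltnW //.
  suff -> : row (Ordinal jn) Phi \notin rows_span Phi j by rewrite addn1.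
  by rewrite rowK; apply: contra (vN (Ordinal jn)) => /(subvP (sub j)).
have full : rows_span Phi n = fullv.
  by apply/eqP; rewrite eqEdim subvf dimR //= dimvf /dim /= mul1n.
have uPhi : Phi \in unitmx.
  rewrite -row_full_unit -sub1mx; apply/row_subP => i.
  have : row i 1%:M \in rows_span Phi n by rewrite full memvf.
  by case/mem_rows_span => y _ ->; apply: submxMl.
exists Phi => //; apply/funext => j; apply/eqP.
by rewrite eqEdim sub dim_rows_span_unit // dimF leqnn.
Qed.

(** [Phi' Phi^-1] preserves the span of the first [j] coordinates, so left multiplication by it
    preserves level [j] of every frame. *)
Lemma rows_span_change (Phi Phi' Psi : 'M[K]_n) j :
  Phi \in unitmx -> Phi' \in unitmx -> Psi \in unitmx ->
  rows_span Phi' j = rows_span Phi j ->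
  rows_span (Phi' *m invmx Phi *m Psi) j = rows_span Psi j.
Proof.
move=> uPhi uPhi' uPsi E; apply/eqP; rewrite eqEdim.
rewrite !dim_rows_span_unit ?leqnn ?andbT ?unitmx_mul ?unitmx_inv ?uPhi ?uPhi' //.
apply/subvP => x /mem_rows_span[y yj ->].
have /mem_rows_span[z zj zE] : y *m Phi' \in rows_span Phi j.
  by rewrite -E; apply/mem_rows_span; exists y.
by apply/mem_rows_span; exists z => //; rewrite !mulmxA zE mulmxK.
Qed.

End FlagFrames.

Section PrincipalOpen.
Variables (n s : nat).

(** The value of [P] depends on the frame, so one good frame is asked for: this is the image of the
    set [P != 0] in the product of flag varieties. *)
Definition principal_open (K : fieldType)
    (P : {mpoly K[#|{: 'I_s * 'I_n * 'I_n}|]}) :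
    set ('I_s -> nat -> {vspace 'rV[K]_n}) :=
  [set F | exists Phi : 'I_s -> 'M[K]_n,
     [/\ forall r, Phi r \in unitmx, F = (fun r => rows_span (Phi r))
       & P.@[all_entries Phi] != 0]]%classic.

Lemma all_entriesE (K : fieldType) (Phi : 'I_s -> 'M[K]_n) v :
  all_entries Phi v = Phi (enum_val v).1.1 (enum_val v).1.2 (enum_val v).2.
Proof. by rewrite /all_entries; case: (enum_val v) => [[r i] j]. Qed.

Lemma mpoly_frame_change (K : fieldType) (b : 'I_s -> 'M[K]_n)
    (P : {mpoly K[#|{: 'I_s * 'I_n * 'I_n}|]}) :
  exists Q : {mpoly K[#|{: 'I_s * 'I_n * 'I_n}|]}, forall Phi,
    Q.@[all_entries Phi] = P.@[all_entries (fun r => b r *m Phi r)].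
Proof.
pose lin (t : 'I_s * 'I_n * 'I_n) : {mpoly K[#|{: 'I_s * 'I_n * 'I_n}|]} :=
  \sum_k b t.1.1 t.1.2 k *: 'X_(enum_rank (t.1.1, k, t.2)).
exists (P \mPo [tuple lin (enum_val v) | v < _]) => Phi.
rewrite comp_mpoly_meval; apply: meval_eq => v.
rewrite tnth_mktuple all_entriesE mxE raddf_sum /=; apply: eq_bigr => k _.
by rewrite mevalZ mevalXU all_entriesE enum_rankK.
Qed.

(** If [P] is nonzero at another frame [b Phi] of the same flags, then [P] composed with
    multiplication by [b] is nonzero at [Phi], and wherever it is nonzero the flags belong to the
    set. These composites describe the set by polynomials. *)
Lemma principal_open_open (K : fieldType)
    (P : {mpoly K[#|{: 'I_s * 'I_n * 'I_n}|]}) :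
  zariski_open (principal_open P).
Proof.
split=> [F [Phi [uPhi -> _]] r|]; first exact: rows_span_complete_flag.
exists [set p | forall Phi : 'I_s -> 'M[K]_n, (forall r, Phi r \in unitmx) ->
  p.@[all_entries Phi] != 0 -> principal_open P (fun r => rows_span (Phi r))]%classic.
move=> Phi uPhi; split; last by case=> p; apply.
move=> [Phi' [uPhi' E P0]].
pose b r := Phi' r *m invmx (Phi r).
have [Q QE] := mpoly_frame_change b P; exists Q.
  move=> Psi uPsi Q0; exists (fun r => b r *m Psi r); split.
  - by move=> r; rewrite !unitmx_mul unitmx_inv uPhi uPhi' uPsi.
  - apply/funext => r; apply/funext => j; rewrite rows_span_change //.
    by have := congr1 (fun G => G r j) E.
  - by rewrite -QE.
by rewrite QE; congr (_.@[_] != 0): P0; congr all_entries; apply/funext => r; rewrite /b mulmxKV.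
Qed.

(** [P], a polynomial [p] from the description of [W] and the product [d] of the determinants of the
    frames are nonzero; a nonroot of their product gives invertible frames of flags in both sets. *)
Lemma principal_open_dense (K : numFieldType)
    (P : {mpoly K[#|{: 'I_s * 'I_n * 'I_n}|]}) :
  P != 0 -> zariski_dense (principal_open P).
Proof.
move=> P0 W [Wflag [S SW]] [F WF].
have /fin_all_exists2[Phi uPhi PhiF] r := complete_flag_frame (Wflag F WF r).
have FE : F = (fun r => rows_span (Phi r)) by apply/funext => r.
have [p Sp pPhi] : exists2 p, S p & p.@[all_entries Phi] != 0.
  by apply/SW => //; rewrite -FE.
have p0 : p != 0 by apply: contraNneq pPhi => ->; rewrite meval0.
pose frames (x : 'I_s * 'I_n * 'I_n -> K) r : 'M[K]_n := \matrix_(i, j) x (r, i, j).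
have [d dE] : polyfun (fun x => \prod_r \det (frames x r)).
  apply: polyfun_prod => r; apply: polyfun_det => i j.
  by apply: polyfun_ext (polyfunX K (r, i, j)) => x; rewrite mxE.
pose ent (Psi : 'I_s -> 'M[K]_n) (t : 'I_s * 'I_n * 'I_n) := Psi t.1.1 t.1.2 t.2.
have entE Psi : (fun v => ent Psi (enum_val v)) =1 all_entries Psi.
  by move=> v; rewrite all_entriesE.
have entK Psi : frames (ent Psi) =1 Psi.
  by move=> r; apply/matrixP => i j; rewrite mxE.
have d0 : d != 0.
  have : \prod_r \det (frames (ent Phi) r) != 0.
    by apply/prodf_neq0 => r _; rewrite entK -unitfE -unitmxE.
  by apply: contraNneq => d0; rewrite dE d0 meval0.
have [v] := mpoly_nonroot (mulf_neq0 (mulf_neq0 P0 p0) d0).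
pose Psi := frames (fun t => v (enum_rank t)).
have vE : v =1 all_entries Psi.
  by move=> w; rewrite all_entriesE mxE -!surjective_pairing enum_valK.
rewrite !mevalM !mulf_eq0 !negb_or !(meval_eq _ vE) => /andP[/andP[PPsi pPsi]].
rewrite -(meval_eq _ (entE Psi)) -dE => /prodf_neq0 dPsi.
have uPsi r : Psi r \in unitmx by rewrite unitmxE unitfE -entK dPsi.
exists (fun r => rows_span (Psi r)); split; first by exists Psi.
by apply/SW => //; exists p.
Qed.

End PrincipalOpen.

(** * The dual Schubert condition *)

Lemma part_lt n l (a : seq nat) i j : schubert_cond n l a ->
  (1 <= i)%N -> (i < j <= l)%N -> (part a i < part a j)%N.
Proof.
case/and3P => /eqP sza srt _; case: i j => [//|i] [//|j] _ /andP[ij jl].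
rewrite /part /= (sorted_ltn_nth ltn_trans) // ?inE sza //.
by rewrite -ltnS (ltn_trans ij).
Qed.

Lemma part_le n l (a : seq nat) i j : schubert_cond n l a ->
  (1 <= i)%N -> (i <= j <= l)%N -> (part a i <= part a j)%N.
Proof.
move=> aP i1; rewrite leq_eqVlt => /andP[/orP[/eqP -> //|ij] jl].
by rewrite ltnW // (part_lt aP) // ij.
Qed.

Lemma part_leE n l (a : seq nat) i u : schubert_cond n l a ->
  (1 <= i <= l)%N -> (part a i <= u)%N = (i <= cnt a u)%N.
Proof.
case/and3P => /eqP sza srt _; case: i => [//|i] /andP[_ il].
by rewrite /part /= nth_leq_cnt // sza.
Qed.

Lemma cnt_le n l (a : seq nat) u : schubert_cond n l a -> (cnt a u <= l)%N.
Proof. by case/and3P => /eqP <- _ _; apply: count_size. Qed.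

Lemma cnt_lipschitz (a : seq nat) u v : uniq a -> (u <= v)%N ->
  (cnt a v <= cnt a u + (v - u))%N.
Proof.
move=> ua uv.
have -> : cnt a v = (cnt a u + count (fun x => u < x <= v)%N a)%N.
  rewrite /cnt; elim: a {ua} => [//|x a IHa] /=; rewrite {}IHa.
  by case: (leqP x u) (leqP x v) => xu [] xv /=; lia.
rewrite leq_add2l -size_filter -[leqRHS](size_iota u.+1).
apply: uniq_leq_size; first exact: filter_uniq.
by move=> x; rewrite mem_filter mem_iota => /andP[/andP[-> xv] _] /=; lia.
Qed.

Lemma schubert_cond_uniq n l (a : seq nat) : schubert_cond n l a -> uniq a.
Proof. by case/and3P => _ srt _; apply: (sorted_uniq ltn_trans ltnn). Qed.

Lemma card_part_le n l (a : seq nat) u : schubert_cond n l a ->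
  #|[pred i : 'I_l | (part a i.+1 <= u)%N]| = cnt a u.
Proof.
move=> aP; rewrite -[RHS](@card_ltn_ord l) ?(cnt_le _ aP) //.
by apply: eq_card => i; rewrite !inE (part_leE _ aP) // ltn_ord.
Qed.

Lemma card_part_le_rev n l (a : seq nat) u : schubert_cond n l a ->
  #|[pred i : 'I_l | (part a (l - i) <= u)%N]| = cnt a u.
Proof.
move=> aP; rewrite -(card_part_le u aP) -!sum1_card.
rewrite [RHS](reindex_inj rev_ord_inj); apply: eq_bigl => i.
by rewrite !inE /= subnSK.
Qed.

Section Perp.
Variables (n l : nat) (a : seq nat).
Hypothesis aP : schubert_cond n l a.

(** Among [1, ..., w] exactly those [j] are missing from [perp n a] for which [n + 1 - j] is an
    entry of [a] above [n - w]; there are [l - cnt a (n - w)] of them. *)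
Lemma cnt_perp w : (w <= n)%N -> (cnt (perp n a) w + l = w + cnt a (n - w))%N.
Proof.
have /and3P[/eqP sza srt /allP bnd] := aP; have ua := schubert_cond_uniq aP.
move=> wn; pose P j := (n.+1 - j)%N \in a.
have cntE : cnt (perp n a) w = count (predC P) (iota 1 w).
  rewrite /cnt /perp count_filter -[in LHS](subnKC wn) iotaD count_cat.
  rewrite [X in (_ + X)%N](_ : _ = 0%N) ?addn0; last first.
    apply/eqP; rewrite -leqn0 leqNgt -has_count -all_predC; apply/allP => j.
    rewrite mem_iota => /andP[wj _] /=; rewrite leqNgt.
    by have -> : (w < j)%N by lia.
  apply: eq_in_count => j; rewrite mem_iota => /andP[_ jw] /=.
  rewrite subnKC //.
  by have -> : (j <= w)%N by lia.
have topE : count P (iota 1 w) = (l - cnt a (n - w))%N.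
  have -> : (l - cnt a (n - w) = count (fun x => n - w < x)%N a)%N.
    rewrite -sza -(count_predC (fun x => x <= n - w)%N a) addKn.
    by apply: eq_count => x /=; rewrite ltnNge.
  rewrite -!size_filter -(size_map (fun j => n.+1 - j)%N); apply/perm_size/uniq_perm.
  - rewrite map_inj_in_uniq ?filter_uniq ?iota_uniq // => j k.
    by rewrite !mem_filter !mem_iota => /andP[_ jw] /andP[_ kw]; lia.
  - exact: filter_uniq.
  move=> x; rewrite mem_filter; apply/mapP/andP => [|[xw xa]].
    by case=> j; rewrite mem_filter mem_iota => /andP[Pj jw] ->; split=> //; lia.
  have /andP[x1 xn] := bnd x xa; exists (n.+1 - x)%N; last by lia.
  rewrite mem_filter mem_iota /P subKn ?xa /=; last by rewrite ltnW.
  lia.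
have := count_predC P (iota 1 w); rewrite size_iota -cntE topE.
have := cnt_le (n - w) aP; lia.
Qed.

Lemma perp_cond : (l <= n)%N -> schubert_cond n (n - l) (perp n a).
Proof.
move=> ln; apply/and3P; split.
- have := cnt_perp (leqnn n); rewrite subnn.
  have -> : cnt a 0 = 0%N.
    apply/eqP; rewrite -leqn0 leqNgt -has_count -all_predC.
    by have /and3P[_ _] := aP; apply: sub_all => x /=; rewrite -ltnNge => /andP[].
  have -> : cnt (perp n a) n = size (perp n a).
    apply/eqP; rewrite -all_count; apply/allP => j.
    by rewrite mem_filter mem_iota => /andP[_]; rewrite add1n ltnS => /andP[].
  by move=> E; apply/eqP; lia.
- by apply: sorted_filter (iota_ltn_sorted _ _); apply: ltn_trans.
by apply/allP => j; rewrite mem_filter mem_iota => /andP[_]; rewrite add1n ltnS.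
Qed.

End Perp.

Section PerpPair.
Variables (n l : nat) (a b : seq nat).
Hypotheses (ln : (l <= n)%N) (aP : schubert_cond n l a) (bP : schubert_cond n l b).
Hypothesis pair : forall j, (1 <= j <= l)%N ->
  (n.+1 <= part a j + part b (l.+1 - j))%N.

(** For [j = cnt a w > 0] the entry [a_j] is at most [w], so the pair condition puts [b_(l+1-j)]
    above [n - w]. *)
Lemma pair_cnt w : (cnt a w + cnt b (n - w) <= l)%N.
Proof.
have [j0|jpos] := posnP (cnt a w); first by rewrite j0 (cnt_le _ bP).
have jl : (1 <= cnt a w <= l)%N by rewrite jpos (cnt_le _ aP).
have : (part a (cnt a w) <= w)%N by rewrite (part_leE _ aP).
have := pair jl; rewrite leqNgt => p1 p2; rewrite leqNgt; apply/negP => lt.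
have bl : (1 <= l.+1 - cnt a w <= l)%N by lia.
have : (part b (l.+1 - cnt a w) <= n - w)%N by rewrite (part_leE _ bP) //; lia.
have := part_bounds bP bl; lia.
Qed.

(** If the two entries [d] and [e] had [d + e <= n], the sum of [cnt_perp] at [d] and at [e] would
    contradict [pair_cnt] at [d], as [cnt a] grows by at most [n - e - d] from [d] to [n - e]. *)
Lemma perp_pair j : (1 <= j <= n - l)%N ->
  (n.+1 <= part (perp n b) j + part (perp n a) ((n - l).+1 - j))%N.
Proof.
move=> jm; have j'm : (1 <= (n - l).+1 - j <= n - l)%N by lia.
have [cd _] := cnt_part (perp_cond bP ln) jm.
have [ce _] := cnt_part (perp_cond aP ln) j'm.
have /andP[d1 dn] := part_bounds (perp_cond bP ln) jm.
have /andP[e1 en] := part_bounds (perp_cond aP ln) j'm.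
have := cnt_perp bP dn; rewrite cd => Ed.
have := cnt_perp aP en; rewrite ce => Ee.
rewrite leqNgt; apply/negP.
move: (part (perp n b) _) (part (perp n a) _) cd ce d1 dn e1 en Ed Ee.
move=> d e _ _ d1 dn e1 en Ed Ee lt.
have de : (d <= n - e)%N by lia.
have := cnt_lipschitz (schubert_cond_uniq aP) de; have := pair_cnt d.
lia.
Qed.

End PerpPair.

(** * Local coordinates *)

Section LinearAlgebra.
Variables (K : fieldType) (n : nat).
Local Notation V := 'rV[K]_n.

Lemma w0V m : ((w0 m)^-1 = w0 m)%g.
Proof.
apply/permP => i; apply: (perm_inj (s := w0 m)).
by rewrite permKV !permE /= rev_ordK.
Qed.

Lemma mul_perm_w0 p m (y : 'M[K]_(p, m)) i j :
  (y *m perm_mx (w0 m)) i j = y i (rev_ord j).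
Proof. by rewrite -[w0 m]invgK -col_permE mxE w0V permE. Qed.

Lemma mem_rows_span_rev m (L : 'M[K]_(m, n)) u (x : V) :
  reflect (exists2 y : 'rV_m, (forall i : 'I_m, (i + u < m)%N -> y 0 i = 0)
                              & x = y *m L)
          (x \in rows_span (perm_mx (w0 m) *m L) u).
Proof.
apply: (iffP (mem_rows_span _ _ _)) => [[y yu ->]|[y yu ->]].
  exists (y *m perm_mx (w0 m)); last by rewrite mulmxA.
  by move=> i iu; rewrite mul_perm_w0 yu //=; lia.
exists (y *m perm_mx (w0 m)).
  by move=> i ui; rewrite mul_perm_w0 yu //=; have := ltn_ord i; lia.
rewrite mulmxA -[_ *m _ *m perm_mx _]mulmxA -perm_mxM.
by rewrite -{2}w0V mulgV perm_mx1 mulmx1.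
Qed.

Lemma mem_rows_span_rev_unit (Phi : 'M[K]_n) u (x : V) : Phi \in unitmx ->
  reflect (forall i : 'I_n, (i + u < n)%N -> (x *m invmx Phi) 0 i = 0)
          (x \in rows_span (perm_mx (w0 n) *m Phi) u).
Proof.
move=> uPhi; apply: (iffP (mem_rows_span_rev _ _ _)) => [[y yu ->]|xu].
  by rewrite mulmxK.
by exists (x *m invmx Phi); rewrite // mulmxKV.
Qed.

Lemma unitmx_w0 (Phi : 'M[K]_n) :
  Phi \in unitmx -> perm_mx (w0 n) *m Phi \in unitmx.
Proof. by rewrite unitmx_mul unitmx_perm. Qed.

Lemma row_free_w0 m (L : 'M[K]_(m, n)) :
  row_free L -> row_free (perm_mx (w0 m) *m L).
Proof.
rewrite /row_free => /eqP rL.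
by rewrite eqmxMfull ?rL ?row_full_unit ?unitmx_perm.
Qed.

Lemma row_free_echelon m (L : 'M[K]_(m, n)) (f : 'I_m -> 'I_n) :
  {homo f : i j / (i < j)%N} -> (forall i, L i (f i) = 1) ->
  (forall i (j : 'I_n), (j < f i)%N -> L i j = 0) -> row_free L.
Proof.
move=> f_mono L1 L0; rewrite -kermx_eq0; apply/rowV0P => y /sub_kermxP yL.
apply/rowP => i; rewrite mxE; have [k] := ubnP i.
elim: k i => [//|k IHk] i; rewrite ltnS => ik.
have /rowP/(_ (f i)) := yL; rewrite !mxE (bigD1 i) //= L1 mulr1.
rewrite big1 ?addr0 // => j ji; have [lt|gt|/val_inj E] := ltngtP j i.
- by rewrite IHk ?mul0r // (leq_trans lt).
- by rewrite L0 ?mulr0 // f_mono.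
- by rewrite E eqxx in ji.
Qed.

(** The columns of [C] in [J] are independent linear forms vanishing on [S]. *)
Lemma annihilated_dim (S : {vspace V}) p (C : 'M[K]_(n, p)) (J : {set 'I_p}) :
  row_free C^T -> (forall x, x \in S -> forall i, i \in J -> (x *m C) 0 i = 0) ->
  (\dim S + #|J| <= n)%N.
Proof.
move=> frC SC; pose B := C *m (selmx K (erefl #|J|))^T.
pose f : 'Hom(V, 'rV[K]_#|J|) := linfun (mulmxr B).
have [D DB] : exists D, D *m B = 1%:M.
  apply/row_fullP; rewrite /row_full -mxrank_tr trmx_mul trmxK mxrankMfree //.
  by rewrite rank_selmx.
have limf : limg f = fullv.
  apply/eqP; rewrite eqEsubv subvf; apply/subvP => y _; apply/memv_imgP.
  by exists (y *m D); rewrite ?memvf // lfunE /= -mulmxA DB mulmx1.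
have := limg_ker_dim f fullv; rewrite limf capfv.
rewrite !dimvf /dim /= !mul1n => dimE; rewrite -[leqRHS]dimE leq_add2r; apply: dimvS.
apply/subvP => x xS; rewrite memv_ker lfunE /= mulmxA; apply/eqP/rowP => k.
rewrite mxE big1 ?mxE // => j _.
rewrite [_^T _ _]mxE [selmx _ _ _ _]mxE; case: eqP => [<-|_]; last exact: mulr0.
by rewrite SC ?mul0r // enum_valP.
Qed.

Lemma vspace_rows (S : {vspace V}) :
  exists B : 'M[K]_(\dim S, n), rows_span B (\dim S) = S.
Proof.
exists (\matrix_i (vbasis S)`_i); rewrite -[RHS](span_basis (vbasisP S)).
rewrite /rows_span (eq_filter (a2 := predT)) ?filter_predT; last first.
  by move=> i; rewrite ltn_ord.
congr span; apply: (@eq_from_nth _ 0) => [|i].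
  by rewrite size_map size_enum_ord size_tuple.
rewrite size_map size_enum_ord => iS.
rewrite (nth_map (Ordinal iS)) ?size_enum_ord // rowK.
by rewrite nth_enum_ord.
Qed.

Lemma annihilator (S : {vspace V}) : (\dim S < n)%N ->
  exists2 c : 'cV[K]_n, c != 0 & forall x, x \in S -> x *m c = 0.
Proof.
move=> dimS; have [B BS] := vspace_rows S.
have : cokermx B != 0.
  rewrite -mxrank_eq0 mxrank_coker subn_eq0 -ltnNge.
  exact: leq_ltn_trans (rank_leq_row B) dimS.
rewrite -trmx_eq0 => /rowV0Pn[r /submxP[D rE] r0].
exists r^T; first by rewrite trmx_eq0.
move=> x; rewrite -BS => /mem_rows_span[y _ ->].
by rewrite rE trmx_mul trmxK mulmxA -[y *m B *m _]mulmxA mulmx_coker mulmx0 mul0mx.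
Qed.

Lemma variety_cnt l (al : seq nat) (F : nat -> {vspace V}) H u :
  schubert_cond n l al -> complete_flag F -> schubert_variety l al F H ->
  (cnt al u <= \dim (H :&: F u))%N.
Proof.
move=> alP [_ Fmono] [_ HF]; have [->|c0] := posnP (cnt al u) => //.
have c1 : (1 <= cnt al u <= l)%N by rewrite c0 (cnt_le _ alP).
apply: leq_trans (HF _ c1) _; apply: dimvS; apply: capvS => //.
by apply: Fmono; rewrite (part_leE _ alP).
Qed.

Lemma dim_cap_ge (U W X : {vspace V}) : (U <= X)%VS -> (W <= X)%VS ->
  (\dim U + \dim W <= \dim X + \dim (U :&: W))%N.
Proof.
move=> UX WX; rewrite -dimv_sum_cap leq_add2r; apply: dimvS.
by rewrite subv_add UX.
Qed.

End LinearAlgebra.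

Section CoordM.
Variables (K : fieldType) (n m : nat) (a b : seq nat) (M : 'M[K]_(m, n)).
Hypotheses (aP : schubert_cond n m a) (bP : schubert_cond n m b).

(** The 0-based form without truncated subtraction: row [i] has its leading 1 in column
    [n - part b (m - i)] and vanishes from column [part a i.+1] on. *)
Lemma coordMP :
  coordM a b M <->
  [/\ forall (i : 'I_m) (j : 'I_n), (part a i.+1 <= j)%N -> M i j = 0,
      forall (i : 'I_m) (j : 'I_n), (j + part b (m - i) < n)%N -> M i j = 0
    & forall (i : 'I_m) (j : 'I_n), (j + part b (m - i))%N = n -> M i j = 1].
Proof.
have bn (i : 'I_m) : (1 <= part b (m - i) <= n)%N.
  by apply: (part_bounds bP); have := ltn_ord i; lia.
split=> [MP|[Ma Mb M1] i j].
  split=> i j ij; have [M0 M1] := MP i j; have := bn i.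
  - by move=> _; apply: M0; apply/orP; right; rewrite ltnS.
  - by move=> bni; apply: M0; apply/orP; left; rewrite subSS; lia.
  - by move=> bni; apply: M1; rewrite /forced1 subSS; lia.
have := bn i; split; last first.
  by rewrite /forced1 subSS => /eqP ij; apply: M1; lia.
rewrite /forced0 subSS ltnS => /orP[ij|]; last exact: Ma.
by apply: Mb; lia.
Qed.

Lemma coordM_row_free : coordM a b M -> row_free M.
Proof.
move/coordMP => [_ Mb M1].
have bn (i : 'I_m) : (1 <= part b (m - i) <= n)%N.
  by apply: (part_bounds bP); have := ltn_ord i; lia.
have fn (i : 'I_m) : (n - part b (m - i) < n)%N by have := bn i; lia.
apply: (@row_free_echelon _ _ _ _ (fun i => Ordinal (fn i))) => [i j ij|i|i j] /=.
- have : (part b (m - j) < part b (m - i))%N.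
    by apply: (part_lt bP); have := ltn_ord j; lia.
  by have := bn i; lia.
- by apply: M1 => /=; have := bn i; lia.
- by move=> ji; apply: Mb; have := bn i; lia.
Qed.

End CoordM.

Section PairM.
Variables (K : fieldType) (n l : nat) (a b : seq nat) (Phi : 'M[K]_n).
Hypotheses (ln : (l <= n)%N) (aP : schubert_cond n l a) (bP : schubert_cond n l b).
Hypothesis uPhi : Phi \in unitmx.
Local Notation F := (rows_span Phi).
Local Notation F' := (rows_span (perm_mx (w0 n) *m Phi)).

Lemma row_free_mul_unit (M : 'M[K]_(l, n)) : row_free M -> row_free (M *m Phi).
Proof. by rewrite /row_free mxrankMfree // row_free_unit. Qed.

Lemma dim_coordM (M : 'M[K]_(l, n)) :
  coordM a b M -> \dim (rows_span (M *m Phi) l) = l.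
Proof.
move=> /(coordM_row_free aP bP)/row_free_mul_unit frM.
by rewrite dim_rows_span // minnn.
Qed.

(** The first [u] rows of [M Phi] lie in [F] at level [a_u], the last [u] rows in [F'] at level
    [b_u]. *)
Lemma coordM_variety (M : 'M[K]_(l, n)) : coordM a b M ->
  schubert_variety l a F (rows_span (M *m Phi) l) /\
  schubert_variety l b F' (rows_span (M *m Phi) l).
Proof.
move=> MP; have frM := row_free_mul_unit (coordM_row_free aP bP MP).
have dimH := dim_coordM MP; move: MP => /(coordMP _ aP bP)[Ma Mb _].
split; split=> // u /andP[u1 ul].
  apply: (@leq_trans (\dim (rows_span (M *m Phi) u))).
    by rewrite dim_rows_span // (minn_idPl ul).
  apply: dimvS; rewrite subv_cap rows_spanS //=; apply/subvP => x.
  case/mem_rows_span => y yu ->; apply/mem_rows_span_unit => // j uj.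
  rewrite mulmxA mulmxK // mxE big1 // => k _.
  have [ku|uk] := ltnP k u; last by rewrite yu ?mul0r.
  rewrite Ma ?mulr0 // (leq_trans _ uj) // (part_le aP) //.
  by rewrite ku ul.
have frM' := row_free_w0 frM.
apply: (@leq_trans (\dim (rows_span (perm_mx (w0 l) *m (M *m Phi)) u))).
  by rewrite dim_rows_span // (minn_idPl ul).
apply: dimvS; rewrite subv_cap; apply/andP; split; apply/subvP => x.
  case/mem_rows_span_rev => y _ ->; apply/mem_rows_span; exists y => // i.
  by rewrite leqNgt ltn_ord.
case/mem_rows_span_rev => y yu ->; apply/mem_rows_span_rev_unit => // j ju.
rewrite mulmxA mulmxK // mxE big1 // => k _.
have [ku|uk] := ltnP (k + u)%N l; first by rewrite yu ?mul0r.
rewrite Mb ?mulr0 //; apply: leq_ltn_trans ju; rewrite leq_add2l.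
by apply: (part_le bP); have := ltn_ord k; lia.
Qed.

(** With the second level lowered by one, the counts [i + 1] and [l - i - 1] add up to [l]. This
    gives both a nonzero leading coefficient and the uniqueness of row [i]. *)
Lemma general_cap0 (H : {vspace 'rV[K]_n}) (i : 'I_l) x :
  general_position l a b F F' H ->
  x \in H -> x \in F (part a i.+1) -> x \in F' (part b (l - i)).-1 -> x = 0.
Proof.
move=> gp xH xu xv; have il := ltn_ord i.
have il1 : (1 <= i.+1 <= l)%N by rewrite il.
have il2 : (1 <= l - i <= l)%N by lia.
have [cu _] := cnt_part aP il1; have [_ cv] := cnt_part bP il2.
have un : (part a i.+1 <= n)%N by have /andP[] := part_bounds aP il1.
have vn : ((part b (l - i)).-1 <= n)%N by have := part_bounds bP il2; lia.
have [cap0 _] := gp _ _ un vn; apply/eqP; rewrite -memv0 -cap0 ?memv_cap ?xH ?xu //.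
by rewrite cu cv; lia.
Qed.

Lemma coordM_exists (H : {vspace 'rV[K]_n}) :
  schubert_variety l a F H -> schubert_variety l b F' H ->
  general_position l a b F F' H ->
  exists2 M : 'M[K]_(l, n), coordM a b M & rows_span (M *m Phi) l = H.
Proof.
move=> [dimH Ha] [_ Hb] tr.
have bn (i : 'I_l) : (1 <= part b (l - i) <= n)%N.
  by apply: (part_bounds bP); have := ltn_ord i; lia.
have an (i : 'I_l) : (1 <= part a i.+1 <= n)%N.
  by apply: (part_bounds aP); rewrite ltn_ord.
have /fin_all_exists[z zP] (i : 'I_l) : exists z : 'rV[K]_n,
    [/\ z *m Phi \in H, forall j : 'I_n, (part a i.+1 <= j)%N -> z 0 j = 0,
        forall j : 'I_n, (j + part b (l - i) < n)%N -> z 0 j = 0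
      & forall j : 'I_n, (j + part b (l - i))%N = n -> z 0 j = 1].
  set u := part a i.+1; set v := part b (l - i).
  have il := ltn_ord i.
  have iu : (i.+1 <= \dim (H :&: F u))%N by apply: Ha; rewrite il.
  have iv : (l - i <= \dim (H :&: F' v))%N by apply: Hb; lia.
  (* Inside [H] the dimensions [i + 1] and [l - i] add up to more than [l], so there is a nonzero
     common vector. *)
  have := dim_cap_ge (capvSl H (F u)) (capvSl H (F' v)).
  rewrite dimH => dge; have : (H :&: F u :&: (H :&: F' v) != 0)%VS.
    by rewrite -dimv_eq0 -lt0n; lia.
  rewrite -vpick0; set x := vpick _ => x0.
  have : x \in (H :&: F u :&: (H :&: F' v))%VS by apply: memv_pick.
  rewrite !memv_cap => /andP[/andP[xH xu] /andP[_ xv]].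
  have xu' := mem_rows_span_unit u x uPhi xu.
  have xv' := mem_rows_span_rev_unit v x uPhi xv.
  have jn : (n - v < n)%N by have := bn i; rewrite -/v; lia.
  pose j0 := Ordinal jn; pose w := x *m invmx Phi.
  (* A zero at the prescribed leading position would put [x] one level lower in [F'], hence make it
     0. *)
  have w0 : w 0 j0 != 0.
    apply: contra x0 => /eqP w0.
    have xv1 : x \in F' v.-1.
      apply/mem_rows_span_rev_unit => // j jv.
      have [lt|ge] := ltnP (j + v) n; first exact: xv'.
      rewrite (_ : j = j0) //; apply: val_inj => /=.
      by have := bn i; rewrite -/v; lia.
    by apply/eqP; apply: general_cap0 tr xH xu xv1.
  exists ((w 0 j0)^-1 *: w); split.
  - by rewrite -scalemxAl memvZ // mulmxKV.
  - by move=> j ju; rewrite [LHS]mxE [w 0 j]xu' ?mulr0.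
  - by move=> j jv; rewrite [LHS]mxE [w 0 j]xv' ?mulr0.
  - move=> j jv; rewrite [LHS]mxE (_ : j = j0) ?mulVf //.
    by apply: val_inj; rewrite /= -[LHS](addnK v) jv.
pose M := \matrix_i z i.
have MP : coordM a b M.
  apply/(coordMP _ aP bP); split=> i j ij; rewrite mxE; have [_ z1 z2 z3] := zP i;
    by [apply: z1|apply: z2|apply: z3].
exists M => //; apply/eqP; rewrite eqEdim dim_coordM // dimH leqnn andbT.
apply/subvP => x /mem_rows_span[y _ ->].
rewrite mulmx_sum_row rpred_sum // => i _; rewrite rpredZ // row_mul rowK.
by have [] := zP i.
Qed.

(** In the difference of two rows the leading 1 cancels, so it drops one level in [F'] and
    [general_cap0] applies. *)
Lemma coordM_unique (M M' : 'M[K]_(l, n)) (H : {vspace 'rV[K]_n}) :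
  coordM a b M -> coordM a b M' ->
  rows_span (M *m Phi) l = H -> rows_span (M' *m Phi) l = H ->
  general_position l a b F F' H -> M = M'.
Proof.
move=> /(coordMP _ aP bP)[Ma Mb M1] /(coordMP _ aP bP)[Ma' Mb' M1'] MH MH' tr.
have rowH (L : 'M[K]_(l, n)) i : rows_span (L *m Phi) l = H -> row i L *m Phi \in H.
  move=> <-; apply/mem_rows_span; exists (delta_mx 0 i).
    by move=> j; rewrite leqNgt ltn_ord.
  by rewrite -rowE row_mul.
apply/row_matrixP => i; apply/eqP; rewrite -subr_eq0.
set d := row i M - row i M'.
have dE j : d 0 j = M i j - M' i j by rewrite !mxE.
have : d *m Phi = 0.
  apply: (general_cap0 (i := i) tr).
  - by rewrite mulmxBl rpredB ?rowH.
  - by apply/mem_rows_span; exists d => // j ij; rewrite dE Ma ?Ma' ?subrr.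
  apply/mem_rows_span_rev; exists d => // j ij; rewrite dE.
  have [lt|ge] := ltnP (j + part b (l - i)) n; first by rewrite Mb ?Mb' ?subrr.
  have il : (1 <= l - i <= l)%N by have := ltn_ord i; lia.
  by rewrite M1 ?M1' ?subrr //; have := part_bounds bP il; lia.
move/(congr1 (mulmx^~ (invmx Phi))); rewrite mulmxK // mul0mx => ->.
exact: eqxx.
Qed.

End PairM.

Section PairN.
Variables (K : fieldType) (n l : nat) (a b : seq nat) (Phi : 'M[K]_n).
Hypotheses (ln : (l <= n)%N) (aP : schubert_cond n l a) (bP : schubert_cond n l b).
Hypothesis pair : forall j, (1 <= j <= l)%N ->
  (n.+1 <= part a j + part b (l.+1 - j))%N.
Hypothesis uPhi : Phi \in unitmx.
Local Notation F := (rows_span Phi).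
Local Notation F' := (rows_span (perm_mx (w0 n) *m Phi)).

Definition annihilates (H : {vspace 'rV[K]_n}) p (N : 'M[K]_(n, p)) : Prop :=
  forall x, x \in H -> x *m invmx Phi *m N = 0.

Lemma coordNP (N : 'M[K]_(n, n - l)) :
  coordN a b N <->
  [/\ forall (i : 'I_(n - l)) (j : 'I_n), (part (perp n b) i.+1 <= j)%N -> N j i = 0,
      forall (i : 'I_(n - l)) (j : 'I_n),
        (j + part (perp n a) (n - l - i) < n)%N -> N j i = 0
    & forall (i : 'I_(n - l)) (j : 'I_n),
        (j + part (perp n a) (n - l - i))%N = n -> N j i = 1].
Proof.
have E := coordMP N^T (perp_cond bP ln) (perp_cond aP ln).
split=> [[M MP <-]|[N1 N2 N3]].
  have /(coordMP _ (perp_cond bP ln) (perp_cond aP ln))[M1 M2 M3] := MP.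
  by split=> i j ij; rewrite mxE; [apply: M1|apply: M2|apply: M3].
exists N^T; last exact: trmxK.
by apply/E; split=> i j ij; rewrite mxE; [apply: N1|apply: N2|apply: N3].
Qed.

Lemma coordN_row_free (N : 'M[K]_(n, n - l)) : coordN a b N -> row_free N^T.
Proof.
case=> M MP <-; rewrite trmxK.
exact: coordM_row_free (perp_cond bP ln) (perp_cond aP ln) MP.
Qed.

(* In 0-based indices, column i of N has its leading 1 in row n - e, which is
   the i-th index outside of a, and its last free entry in row d - 1. *)
Lemma perp_numerics (i : 'I_(n - l)) (e := part (perp n a) (n - l - i))
    (d := part (perp n b) i.+1) :
  [/\ (1 <= e <= n)%N, (1 <= d <= n)%N, (n < d + e)%N,
      (cnt a (n - e) + i + e)%N = n /\ (cnt a (n - e).+1 + i + e)%N = n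
    & (cnt b (n - d) + d = i.+1 + l)%N].
Proof.
have im := ltn_ord i.
have i1 : (1 <= n - l - i <= n - l)%N by lia.
have i2 : (1 <= i.+1 <= n - l)%N by rewrite im.
have [c1 c2] := cnt_part (perp_cond aP ln) i1.
have [c3 _] := cnt_part (perp_cond bP ln) i2.
have e1 := part_bounds (perp_cond aP ln) i1.
have d1 := part_bounds (perp_cond bP ln) i2.
have := perp_pair ln aP bP pair i2; rewrite subSS.
move: c1 c2 c3 e1 d1; rewrite -/d -/e; move: {i1 i2} (d) (e) => {d} d {e} e.
move=> c1 c2 c3 e1 d1 de.
have E1 := cnt_perp aP (w := e) ltac:(lia).
have E2 := cnt_perp aP (w := e.-1) ltac:(lia).
have E3 := cnt_perp bP (w := d) ltac:(lia).
have ne : (n - e.-1 = (n - e).+1)%N by lia.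
rewrite ne in E2.
by split; lia.
Qed.

(** As a form in the coordinates of [Phi], [y] vanishes on [F] at level [n - e + 1] and on [F'] at
    level [n - d]. By [perp_numerics] these levels meet the numerical condition under which
    [H + F + F'] is the whole space. *)
Lemma general_sum0 (H : {vspace 'rV[K]_n}) (i : 'I_(n - l)) (y : 'cV[K]_n) :
  general_position l a b F F' H -> annihilates H y ->
  (forall j : 'I_n, (j + part (perp n a) (n - l - i) <= n)%N -> y j 0 = 0) ->
  (forall j : 'I_n, (part (perp n b) i.+1 <= j)%N -> y j 0 = 0) -> y = 0.
Proof.
move=> gp Hy ye yd; have [e1 d1 de [c1 c2] c3] := perp_numerics i.
move: ye yd e1 d1 de c1 c2 c3.
move: (part (perp n a) _) (part (perp n b) _) => e d ye yd e1 d1 de c1 c2 c3.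
have [_ full] := gp (n - e).+1 (n - d)%N ltac:(lia) (leq_subr _ _).
have kills x : x \in F (n - e).+1 -> x *m invmx Phi *m y = 0.
  move/(mem_rows_span_unit _ _ uPhi) => xF; apply/rowP => k.
  rewrite ord1 mxE [RHS]mxE big1 // => j _.
  have [lt|ge] := leqP (n - e).+1 j; first by rewrite xF ?mul0r.
  by rewrite ye ?mulr0 //; lia.
have kills' x : x \in F' (n - d)%N -> x *m invmx Phi *m y = 0.
  move/(mem_rows_span_rev_unit _ _ uPhi) => xF; apply/rowP => k.
  rewrite ord1 mxE [RHS]mxE big1 // => j _.
  have [lt|ge] := leqP d j; first by rewrite yd ?mulr0.
  by rewrite xF ?mul0r //; lia.
apply/row_matrixP => j; rewrite row0.
have : row j Phi \in (H + F (n - e).+1 + F' (n - d)%N)%VS.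
  by rewrite full ?memvf //; lia.
case/memv_addP => x /memv_addP[h hH [f fF ->]] [f' fF' rE].
have : row j Phi *m invmx Phi *m y = 0.
  by rewrite rE !mulmxDl Hy // kills // kills' // !addr0.
by rewrite -row_mul mulmxV // -row_mul mul1mx.
Qed.

Lemma coordN_unique (N N' : 'M[K]_(n, n - l)) (H : {vspace 'rV[K]_n}) :
  coordN a b N -> coordN a b N' -> annihilates H N -> annihilates H N' ->
  general_position l a b F F' H -> N = N'.
Proof.
move=> /coordNP[N1 N2 N3] /coordNP[N1' N2' N3'] HN HN' gp.
apply/trmx_inj/row_matrixP => i; rewrite -!tr_col; congr trmx.
apply/eqP; rewrite -subr_eq0; apply/eqP; apply: (general_sum0 (i := i) gp).
- by move=> x xH; rewrite mulmxBr !colE !mulmxA HN // HN' // mul0mx subrr.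
- move=> j; rewrite leq_eqVlt => /orP[/eqP ij|ij]; rewrite !mxE.
    by rewrite N3 ?N3' ?subrr.
  by rewrite N2 ?N2' ?subrr.
- by move=> j ij; rewrite !mxE N1 ?N1' ?subrr.
Qed.

Lemma coordN_exists (H : {vspace 'rV[K]_n}) :
  schubert_variety l a F H -> schubert_variety l b F' H ->
  general_position l a b F F' H ->
  exists2 N : 'M[K]_(n, n - l), coordN a b N & annihilates H N.
Proof.
move=> Ha Hb gp; have [dimH _] := Ha.
have flagF := rows_span_complete_flag uPhi.
have flagF' := rows_span_complete_flag (unitmx_w0 uPhi).
have /fin_all_exists[y yP] (i : 'I_(n - l)) : exists y : 'cV[K]_n,
    [/\ annihilates H y, forall j : 'I_n, (part (perp n b) i.+1 <= j)%N -> y j 0 = 0,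
        forall j : 'I_n, (j + part (perp n a) (n - l - i) < n)%N -> y j 0 = 0
      & forall j : 'I_n, (j + part (perp n a) (n - l - i))%N = n -> y j 0 = 1].
  have gs := general_sum0 (i := i) gp.
  have [e1 d1 de [c1 _] c3] := perp_numerics i.
  move: gs e1 d1 de c1 c3.
  move: (part (perp n a) _) (part (perp n b) _) => e d gs e1 d1 de c1 c3.
  pose u := (n - e)%N; pose v := (n - d)%N.
  (* Both summands contain [H], so the dimension is at most [l + u + v - cnt a u - cnt b v], which
     is [n - 1]. *)
  have dimS : (\dim (H + F u + (H + F' v)) < n)%N.
    have := dimv_sum_cap H (F u); have := dimv_sum_cap H (F' v).
    have := dimv_sum_cap (H + F u) (H + F' v).
    have := dimvS (U := H) (V := (H + F u) :&: (H + F' v))%VS.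
    rewrite subv_cap !addvSl => /(_ isT).
    have := variety_cnt u aP flagF Ha; have := variety_cnt v bP flagF' Hb.
    rewrite !dim_rows_span_unit ?unitmx_w0 // dimH.
    rewrite /u /v (minn_idPl _) ?leq_subr // (minn_idPl _) ?leq_subr //.
    have := ltn_ord i; lia.
  have [c c0 cS] := annihilator dimS.
  pose y := Phi *m c.
  have yE x : x *m invmx Phi *m y = x *m c by rewrite /y mulmxA mulmxKV.
  have y0 : y != 0.
    apply: contra c0 => /eqP y0; rewrite -[c](mulKmx uPhi) -/y y0 mulmx0.
    exact: eqxx.
  have yH : annihilates H y.
    move=> x xH; rewrite yE; apply: cS.
    by apply: (subvP (addvSl _ _)); apply: (subvP (addvSl _ _)).
  have yrow x (j : 'I_n) : row j Phi \in (H + F u + (H + F' v))%VS -> y j x = 0.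
    move=> /cS; rewrite -row_mul -/y => /rowP/(_ x); by rewrite !mxE.
  have yu (j : 'I_n) : (j + e < n)%N -> y j 0 = 0.
    move=> je; apply: yrow; apply: (subvP (addvSl _ _)); apply: (subvP (addvSr _ _)).
    apply/mem_rows_span_unit => // k uk; rewrite -row_mul mulmxV // row1 mxE eqxx /=.
    by case: eqP => // kj; move: uk; rewrite kj /u; lia.
  have yv (j : 'I_n) : (d <= j)%N -> y j 0 = 0.
    move=> dj; apply: yrow; apply: (subvP (addvSr _ _)); apply: (subvP (addvSr _ _)).
    apply/mem_rows_span_rev_unit => // k vk; rewrite -row_mul mulmxV // row1 mxE eqxx /=.
    by case: eqP => // kj; move: vk; rewrite kj /v; lia.
  have jn : (n - e < n)%N by lia.
  pose j0 := Ordinal jn.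
  (* With one more zero, [y] would vanish by [general_sum0]. *)
  have yj0 : y j0 0 != 0.
    apply: contra y0 => /eqP yj0; apply/eqP/gs => // j.
    rewrite leq_eqVlt => /orP[/eqP je|]; last exact: yu.
    by rewrite (_ : j = j0) //; apply: val_inj => /=; lia.
  exists ((y j0 0)^-1 *: y); split=> [x xH|j dj|j je|j je].
  - by rewrite -scalemxAr yH // scaler0.
  - by rewrite [LHS]mxE [y j 0]yv ?mulr0.
  - by rewrite [LHS]mxE [y j 0]yu ?mulr0.
  by rewrite [LHS]mxE (_ : j = j0) ?mulVf //; apply: val_inj => /=; lia.
exists (\matrix_(j, i) y i j 0).
  apply/coordNP; split=> i j ij; rewrite mxE; have [_ y1 y2 y3] := yP i;
    by [apply: y1|apply: y2|apply: y3].
move=> x xH; apply/rowP => i; rewrite [RHS]mxE.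
have [yH _ _ _] := yP i; have /rowP/(_ 0) := yH x xH.
by rewrite [RHS]mxE => yx; rewrite -[RHS]yx !mxE; apply: eq_bigr => j _; rewrite !mxE.
Qed.

(** Columns whose leading 1 is at or after position [u] vanish on [F_u] and on [H]. They are
    independent and [cnt (perp n a) (n - u)] in number, so [cnt_perp] turns the bound on [H + F_u]
    into the Schubert condition. For [F'] the columns that end early enough are used. *)
Lemma coordN_variety (N : 'M[K]_(n, n - l)) (H : {vspace 'rV[K]_n}) :
  coordN a b N -> \dim H = l -> annihilates H N ->
  schubert_variety l a F H /\ schubert_variety l b F' H.
Proof.
move=> NP dimH HN; have frN := coordN_row_free NP.
have frPN : row_free (invmx Phi *m N)^T.
  by rewrite trmx_mul /row_free mxrankMfree // row_free_unit unitmx_tr unitmx_inv.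
have [N1 N2 _] := (coordNP N).1 NP.
split; split=> // I /[dup] Il /andP[I1 I2].
  have [cI _] := cnt_part aP Il; set u := part a I in cI *.
  have un : (u <= n)%N by have /andP[] := part_bounds aP Il.
  pose J := [set i : 'I_(n - l) | (part (perp n a) (n - l - i) <= n - u)%N].
  have cJ : #|J| = cnt (perp n a) (n - u).
    by rewrite -(card_part_le_rev _ (perp_cond aP ln)) cardsE.
  have := cnt_perp aP (leq_subr u n); rewrite subKn // cI => cP.
  have : (\dim (H + F u) + #|J| <= n)%N.
    apply: annihilated_dim frPN _ => _ /memv_addP[h hH [f fF ->]] i iJ.
    rewrite mulmxA !mulmxDl HN // add0r mxE big1 // => j _.
    have [lt|ge] := leqP u j.
      by rewrite (mem_rows_span_unit _ _ uPhi fF) ?mul0r.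
    by move: iJ; rewrite inE => iJ; rewrite N2 ?mulr0 //; lia.
  have := dimv_sum_cap H (F u); rewrite dimH dim_rows_span_unit // (minn_idPl un).
  lia.
have [cI _] := cnt_part bP Il; set v := part b I in cI *.
have vn : (v <= n)%N by have /andP[] := part_bounds bP Il.
pose J := [set i : 'I_(n - l) | (part (perp n b) i.+1 <= n - v)%N].
have cJ : #|J| = cnt (perp n b) (n - v).
  by rewrite -(card_part_le _ (perp_cond bP ln)) cardsE.
have := cnt_perp bP (leq_subr v n); rewrite subKn // cI => cP.
have : (\dim (H + F' v) + #|J| <= n)%N.
  apply: annihilated_dim frPN _ => _ /memv_addP[h hH [f fF ->]] i iJ.
  rewrite mulmxA !mulmxDl HN // add0r mxE big1 // => j _.
  have [lt|ge] := leqP n (j + v)%N; last first.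
    by rewrite (mem_rows_span_rev_unit _ _ uPhi fF) ?mul0r.
  by move: iJ; rewrite inE => iJ; rewrite N1 ?mulr0 //; lia.
have := dimv_sum_cap H (F' v).
rewrite dimH dim_rows_span_unit ?unitmx_w0 // (minn_idPl vn); lia.
Qed.

End PairN.

(** * The square condition *)

Lemma mulmx_cast_rows (K : fieldType) m m' p (e : m = m') (A : 'M[K]_(m, p)) (y : 'rV_m') :
  y *m castmx (e, erefl p) A = castmx (erefl 1%N, esym e) y *m A.
Proof. by case: m' / e y => y; rewrite !castmx_id. Qed.

Lemma row_free_dim (K : fieldType) m n (M : 'M[K]_(m, n)) :
  \dim (rows_span M m) = m -> row_free M.
Proof.
move=> dimM; pose f : 'Hom('rV[K]_m, 'rV[K]_n) := linfun (mulmxr M).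
have limf : limg f = rows_span M m.
  apply/vspaceP => x; apply/memv_imgP/mem_rows_span => [[y _ ->]|[y _ ->]].
    by exists y; rewrite ?lfunE // => i; rewrite leqNgt ltn_ord.
  by exists y; rewrite ?memvf // lfunE.
have := limg_ker_dim f fullv; rewrite limf capfv dimM dimvf /dim /= mul1n.
move=> kerE; have /eqP : \dim (lker f) = 0%N by lia.
rewrite dimv_eq0 => /eqP ker0; rewrite -kermx_eq0; apply/rowV0P => y /sub_kermxP yM.
by apply/eqP; rewrite -memv0 -ker0 memv_ker lfunE /= yM.
Qed.

Section Square.
Variables (K : fieldType) (n l : nat).
Hypotheses (l0 : (0 < l)%N) (ln : (l < n)%N).

Lemma part_square1 : part (square_cond n l) 1 = (n - l)%N.
Proof. by []. Qed.

Lemma part_square i : (1 < i <= l)%N -> part (square_cond n l) i = (n - l + i)%N.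
Proof.
case: i => [|[|i]] // /andP[_ il]; rewrite /part /= nth_iota; lia.
Qed.

Lemma square_schubert_cond : schubert_cond n l (square_cond n l).
Proof.
apply/and3P; split; first by rewrite /= size_iota prednK.
  rewrite /square_cond /= path_sortedE; last exact: ltn_trans.
  rewrite iota_ltn_sorted andbT; apply/allP => x; rewrite mem_iota; lia.
rewrite /square_cond /=; apply/andP; split; first lia.
by apply/allP => x; rewrite mem_iota; lia.
Qed.

Lemma codim_square : codim n l (square_cond n l) = 1.
Proof.
rewrite /codim big_nat_recl // part_square1.
under eq_big_nat => i il do rewrite part_square ?ltnS // PoszD addrK.
rewrite sumr_const_nat; have : (0 < n - l)%N by rewrite subn_gt0.
rewrite -mulr_natl; case: l l0 => [//|m _]; rewrite subn1 /=; lia.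
Qed.

(** For [i > 1] the condition is at level [n - l + i], where an intersection of dimension [i] is
    automatic. *)
Lemma square_varietyE (F : nat -> {vspace 'rV[K]_n}) (H : {vspace 'rV[K]_n}) :
  complete_flag F -> \dim H = l ->
  schubert_variety l (square_cond n l) F H <-> (H :&: F (n - l)%N)%VS != 0%VS.
Proof.
move=> [dimF _] dimH; split=> [[_ /(_ 1%N)]|cap0].
  by rewrite part_square1 l0 => /(_ isT); rewrite -dimv_eq0 -lt0n.
split=> // i /andP[i0 il]; have [i1|i1] := leqP i 1.
  have -> : i = 1%N by lia.
  by rewrite part_square1 lt0n dimv_eq0.
rewrite part_square ?i1 //.
have := dim_cap_ge (subvf H) (subvf (F (n - l + i)%N)).
rewrite dimF dimvf /dim /= mul1n dimH; lia.
Qed.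

(** A left kernel vector of the stacked matrix is a pair with [y1 L = y2 Psi], up to sign; freeness
    of both blocks makes the common vector nonzero when the pair is. *)
Lemma det_stack_eq0 (hl : (l <= n)%N) (L : 'M[K]_(l, n)) (Psi : 'M[K]_(n - l, n)) :
  row_free L -> row_free Psi ->
  \det (stack hl L Psi) = 0 <->
  (rows_span L l :&: rows_span Psi (n - l) != 0)%VS.
Proof.
move=> frL frPsi; split=> [/eqP/det0P[y y0]|].
  rewrite mulmx_cast_rows -[castmx _ y]hsubmxK mul_row_col.
  set y' := castmx _ y; move/eqP; rewrite addr_eq0 => /eqP E.
  rewrite -subv0; apply/negP => /subvP/(_ (lsubmx y' *m L)).
  rewrite memv_cap memv0 => /(_ _)/eqP cap0.
  have /eqP : lsubmx y' *m L = 0.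
    apply: cap0; apply/andP; split; apply/mem_rows_span.
      by exists (lsubmx y') => // i; rewrite leqNgt ltn_ord.
    by exists (- rsubmx y'); rewrite ?mulNmx // => i; rewrite leqNgt ltn_ord.
  rewrite mulmx_free_eq0 // => /eqP y1.
  have /eqP : rsubmx y' *m Psi = 0 by apply/eqP; rewrite -oppr_eq0 -E y1 mul0mx.
  rewrite mulmx_free_eq0 // => /eqP y2.
  have y'0 : y' = 0 by rewrite -[y']hsubmxK y1 y2 row_mx0.
  case/negP: y0; rewrite -[y](castmxK (erefl 1%N) (esym (subnKC hl))) -/y' y'0.
  by apply/eqP/matrixP => i j; rewrite castmxE !mxE.
rewrite -vpick0 => x0; have := memv_pick (rows_span L l :&: rows_span Psi (n - l))%VS.
rewrite memv_cap => /andP[/mem_rows_span[y1 _ E1] /mem_rows_span[y2 _ E2]].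
apply/eqP/det0P; exists (castmx (erefl 1%N, subnKC hl) (row_mx y1 (- y2))).
  apply: contra x0 => /eqP E; have : row_mx y1 (- y2) = 0.
    rewrite -[row_mx _ _](castmxK (erefl 1%N) (subnKC hl)) E.
    by apply/matrixP => i j; rewrite castmxE !mxE.
  by rewrite -[0]row_mx0 => /eq_row_mx[y10 _]; rewrite E1 y10 mul0mx.
by rewrite mulmx_cast_rows (castmxK (erefl 1%N) (subnKC hl)) mul_row_col mulNmx -E1 -E2 subrr.
Qed.

End Square.

(** * The polynomial system *)

Section Fill.
Variables (n m : nat) (a b : seq nat).

(** Over an arbitrary ring, so that the same matrix serves over [K] and, filled with variables, over
    polynomials; [map_fill] relates the two under evaluation. *)
Definition fill (S : nzRingType) (g : freeM n m a b -> S) : 'M[S]_(m, n) :=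
  \matrix_(i, j) if forced0 n m a b i.+1 j.+1 then 0
                 else if forced1 n m a b i.+1 j.+1 then 1
                 else oapp g 0 (insub (i, j)).

Lemma eq_fill (S : nzRingType) (g g' : freeM n m a b -> S) :
  g =1 g' -> fill g = fill g'.
Proof.
move=> gg'; apply/matrixP => i j; rewrite !mxE.
by case: ifP => // _; case: ifP => // _; case: insubP => //= p _ _.
Qed.

Lemma map_fill (S S' : nzRingType) (f : {rmorphism S -> S'})
    (g : freeM n m a b -> S) :
  map_mx f (fill g) = fill (fun p => f (g p)).
Proof.
apply/matrixP => i j; rewrite !mxE.
case: ifP => _; first exact: rmorph0.
case: ifP => _; first exact: rmorph1.
by case: insubP => [p _ _|_] //=; apply: rmorph0.
Qed.

Lemma fill_free (S : nzRingType) (g : freeM n m a b -> S) (p : freeM n m a b) :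
  fill g (val p).1 (val p).2 = g p.
Proof.
have /andP[/negPf p0 /negPf p1] := valP p.
by rewrite mxE p0 p1 -surjective_pairing valK.
Qed.

Lemma coordM_fill (K : fieldType) (M : 'M[K]_(m, n)) : coordM a b M ->
  fill (fun p => M (val p).1 (val p).2) = M.
Proof.
move=> MP; apply/matrixP => i j; rewrite mxE; have [M0 M1] := MP i j.
case: ifPn => [/M0 //|n0]; case: ifPn => [/M1 //|n1].
case: insubP => [p _ /= -> //|]; by rewrite n0 n1.
Qed.

(** The pair condition keeps the leading 1 of each row within the right bound, so the positions
    forced to 1 are not forced to 0. *)
Lemma fill_coordM (K : fieldType) (g : freeM n m a b -> K) :
  (forall j, (1 <= j <= m)%N -> (n.+1 <= part a j + part b (m.+1 - j))%N) ->
  coordM a b (fill g).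
Proof.
move=> pair i j; rewrite mxE; split=> [-> //|f1].
have /negPf -> : ~~ forced0 n m a b i.+1 j.+1; last by rewrite f1.
have im : (1 <= i.+1 <= m)%N by rewrite ltn_ord.
have := pair _ im; move: f1; rewrite /forced0 /forced1 => /eqP -> /=.
by move=> ?; rewrite ltnn /= -leqNgt; lia.
Qed.

End Fill.

Section System.
Variables (K : fieldType) (n l k : nat) (hk : (0 < k)%N).
Variable alpha : 'I_(2 * k) -> seq nat.
Hypothesis ln : (l <= n)%N.
Hypothesis alphaP : forall i, schubert_cond n l (alpha i).
Hypothesis pair : forall (i : 'I_k) (j : nat), (1 <= j <= l)%N ->
  (n.+1 <= part (alpha (pair_fst i)) j + part (alpha (pair_snd i)) (l.+1 - j))%N.

Local Notation vars := (variables n l hk alpha).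

Definition assemble (S : nzRingType) (g : vars -> S) :
    'M[S]_(l, n) * ('I_k.-1 -> 'M[S]_(n, n - l)) :=
  (fill (fun p => g (inl p)),
   fun i => (fill (fun p : varsN n l alpha i => g (inr (Tagged (varsN n l alpha) p))))^T).

Lemma assemble_coordMN (MN : unknowns K n l k) : coordMN hk alpha MN ->
  (assemble (free_entry hk alpha MN)).1 = MN.1 /\
  forall i, (assemble (free_entry hk alpha MN)).2 i = MN.2 i.
Proof.
case=> MP NP; split=> [|i]; first exact: coordM_fill MP.
have [L LP LN] := NP i; rewrite -LN -[in RHS](coordM_fill LP); congr trmx.
by apply: eq_fill => p /=; rewrite -LN mxE.
Qed.

Lemma free_entries_bij :
  set_bij (@coordMN K n l k hk alpha) setT (@free_entries K n l k hk alpha).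
Proof.
split=> // [MN MN' /set_mem MNP /set_mem MNP' E|g _].
  have E' : free_entry hk alpha MN =1 free_entry hk alpha MN'.
    by move=> w; have := congr1 (@^~ (enum_rank w)) E; rewrite /free_entries enum_rankK.
  have [M1 N1] := assemble_coordMN MNP; have [M2 N2] := assemble_coordMN MNP'.
  case: MN MN' E' M1 N1 M2 N2 {E MNP MNP'} => [M N] [M' N'] /= E' M1 N1 M2 N2.
  congr (_, _); first by rewrite -M1 -M2; apply: eq_fill => p; exact: (E' (inl p)).
  apply/ffunP => i; rewrite -N1 -N2; congr trmx; apply: eq_fill => p.
  exact: (E' (inr (Tagged (varsN n l alpha) p))).
pose h := assemble (fun w => g (enum_rank w)).
pose MN : unknowns K n l k := (h.1, [ffun i => h.2 i]).
exists MN; first split=> [|i] /=.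
- by apply: fill_coordM; apply: pair.
- rewrite ffunE; eexists; last reflexivity.
  apply: fill_coordM; apply: perp_pair => //; exact: pair.
apply/funext => v; rewrite /free_entries -[in RHS](enum_valK v).
case: (enum_val v) => [p|[i p]] /=; first by rewrite fill_free.
by rewrite ffunE mxE fill_free.
Qed.

Local Notation poly := {mpoly K[#|vars|]}.

Definition generic_unknowns := assemble (fun w : vars => 'X_(enum_rank w) : poly).

Lemma eval_generic (MN : unknowns K n l k) : coordMN hk alpha MN ->
  map_mx (meval (free_entries hk alpha MN)) generic_unknowns.1 = MN.1 /\
  forall i, map_mx (meval (free_entries hk alpha MN)) (generic_unknowns.2 i) = MN.2 i.
Proof.
have eval w : meval (free_entries hk alpha MN) ('X_(enum_rank w) : poly) = free_entry hk alpha MN w.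
  by rewrite mevalXU /free_entries enum_rankK.
move=> /assemble_coordMN[<- N]; split=> [|i].
  by rewrite map_fill; apply: eq_fill => p; apply: eval.
by rewrite -N -map_trmx map_fill; congr trmx; apply: eq_fill => p; apply: eval.
Qed.

Definition constmx p q (A : 'M[K]_(p, q)) : 'M[poly]_(p, q) :=
  map_mx (@mpolyC _ K) A.

Lemma eval_constmx p q (A : 'M[K]_(p, q)) x : map_mx (meval x) (constmx A) = A.
Proof. by apply/matrixP => i j; rewrite !mxE mevalC. Qed.

Definition linear_in (P : pred vars) (p : poly) : Prop :=
  forall mu, mu \in msupp p ->
    (\sum_(v : vars | P v) mu (enum_rank v) <= 1)%N /\
    forall v, ~~ P v -> mu (enum_rank v) = 0%N.

Lemma linear_in0 P : linear_in P 0.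
Proof. by move=> mu; rewrite msupp0. Qed.

Lemma linear_in1 P : linear_in P 1.
Proof.
move=> mu; rewrite -mpolyC1 msupp1 inE => /eqP ->.
split; first by rewrite big1 // => v _; rewrite mnm0E.
by move=> v _; rewrite mnm0E.
Qed.

Lemma linear_inX (P : pred vars) (w : vars) :
  P w -> linear_in P 'X_(enum_rank w).
Proof.
move=> Pw mu; rewrite msuppX inE => /eqP ->; split=> [|v Pv].
  rewrite (bigD1 w) //= mnm1E eqxx big1 ?addn0 // => v /andP[_ vw].
  by rewrite mnm1E (inj_eq enum_rank_inj) eq_sym (negPf vw).
by rewrite mnm1E (inj_eq enum_rank_inj); case: eqP Pw Pv => // -> ->.
Qed.

Lemma linear_in_sum (P : pred vars) (I : finType) (f : I -> poly) :
  (forall i, linear_in P (f i)) -> linear_in P (\sum_i f i).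
Proof.
move=> fP mu /msupp_sum_le /flattenP[s /mapP[i _ ->]]; exact: fP.
Qed.

Lemma linear_inMC P p c : linear_in P p -> linear_in P (p * c%:MP).
Proof. by move=> pP mu; rewrite mulrC mul_mpolyC => /msuppZ_le; apply: pP. Qed.

Lemma linear_in_fill (P : pred vars) m a b (g : freeM n m a b -> vars) i j :
  (forall p, P (g p)) -> linear_in P (fill (fun p => 'X_(enum_rank (g p)) : poly) i j).
Proof.
move=> gP; rewrite mxE; case: ifP => _; first exact: linear_in0.
case: ifP => _; first exact: linear_in1.
by case: insubP => [p _ _|_] /=; [apply: linear_inX|apply: linear_in0].
Qed.

Lemma bilinear_sum (i : 'I_k.-1) (I : finType) (f : I -> poly) :
  (forall j, bilinear_eqn i (f j)) -> bilinear_eqn i (\sum_j f j).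
Proof.
move=> fP mu /msupp_sum_le /flattenP[s /mapP[j _ ->]]; exact: fP.
Qed.

(** [M] and [N_i] have disjoint sets of variables, so each exponent of the product comes from one
    factor only. *)
Lemma bilinear_mul (i : 'I_k.-1) (p q : poly) :
  linear_in (@in_M n l k hk alpha) p -> linear_in (in_N i) q ->
  bilinear_eqn i (p * q).
Proof.
move=> pP qP mu /msuppM_le /allpairsP[[m1 m2] /= [/pP[m1M m1_0] /qP[m2N m2_0] ->]].
have disj (v : vars) : in_M v -> ~~ in_N i v by case: v.
split=> [||v vM vN]; last by rewrite mnmDE m1_0 ?m2_0.
- rewrite (eq_bigr (fun v => m1 (enum_rank v))) // => v vM.
  by rewrite mnmDE m2_0 ?addn0 // disj.
rewrite (eq_bigr (fun v => m2 (enum_rank v))) // => v vN.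
by rewrite mnmDE m1_0 //; apply: contraL vN => /disj.
Qed.

Definition product_eqn (A : 'M[K]_n) (i : 'I_k.-1) : 'M[poly]_(l, n - l) :=
  generic_unknowns.1 *m constmx A *m generic_unknowns.2 i.

Lemma bilinear_product_eqn A i p q : bilinear_eqn i (product_eqn A i p q).
Proof.
rewrite mxE; apply: bilinear_sum => j; apply: bilinear_mul.
  rewrite mxE; apply: linear_in_sum => j'; rewrite [constmx _ _ _]mxE.
  apply: linear_inMC; exact: linear_in_fill.
by rewrite mxE; apply: linear_in_fill => p' /=.
Qed.

Lemma eval_product_eqn A i (MN : unknowns K n l k) : coordMN hk alpha MN ->
  map_mx (meval (free_entries hk alpha MN)) (product_eqn A i) = MN.1 *m A *m MN.2 i.
Proof.
by move=> /eval_generic[E1 E2]; rewrite !map_mxM eval_constmx E1 E2.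
Qed.

Definition stack_eqn (A : 'M[K]_n) (Psi : 'M[K]_(n - l, n)) : poly :=
  \det (castmx (subnKC ln, erefl n)
    (col_mx (generic_unknowns.1 *m constmx A) (constmx Psi))).

Lemma eval_stack_eqn A Psi (MN : unknowns K n l k) : coordMN hk alpha MN ->
  (stack_eqn A Psi).@[free_entries hk alpha MN] = \det (stack ln (MN.1 *m A) Psi).
Proof.
move=> /eval_generic[E1 _]; rewrite -det_map_mx map_castmx map_col_mx map_mxM.
by rewrite !eval_constmx E1.
Qed.

End System.

(** * Counting the variables *)

Lemma sum_part n l (a : seq nat) : schubert_cond n l a ->
  (\sum_(i < l) part a i.+1 = \sum_(x <- a) x)%N.
Proof.
case/and3P => /eqP sza _ _; rewrite [RHS](big_nth 0%N) sza big_mkord.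
exact: eq_bigr.
Qed.

(** In 0-based indices, row [i] has [a_(i+1) + b_(m-i) - (n + 1)] free entries, those after its
    leading 1 up to its right bound. *)
Lemma card_freeM n m (a b : seq nat) :
  schubert_cond n m a -> schubert_cond n m b ->
  (forall j, (1 <= j <= m)%N -> (n.+1 <= part a j + part b (m.+1 - j))%N) ->
  (#|freeM n m a b| + m * n.+1 = \sum_(x <- a) x + \sum_(x <- b) x)%N.
Proof.
move=> aP bP pair.
have rowE (i : 'I_m) :
    (#|[pred j : 'I_n | ~~ forced0 n m a b i.+1 j.+1 && ~~ forced1 n m a b i.+1 j.+1]|
      + n.+1 = part a i.+1 + part b (m - i))%N.
  have im := ltn_ord i.
  have i1 : (1 <= i.+1 <= m)%N by rewrite im.
  have i2 : (1 <= m - i <= m)%N by lia.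
  have := pair _ i1; rewrite subSS.
  have := part_bounds aP i1; have := part_bounds bP i2.
  rewrite /forced0 /forced1 !subSS.
  move: (part a _) (part b _) => u v v1 u1 uv.
  have vn : (n.+1 - v <= n)%N by lia.
  have un : (u <= n)%N by lia.
  have uE : (#|[pred j : 'I_n | (j < u)%N && (n.+1 - v <= j)%N]| + (n.+1 - v) = u)%N.
    rewrite -{2}(card_ltn_ord vn) -[RHS](card_ltn_ord un).
    rewrite -[RHS](cardID [pred j : 'I_n | (j < n.+1 - v)%N]) addnC.
    by congr (_ + _)%N; apply: eq_card => j; rewrite !inE; lia.
  rewrite -[X in (_ = X + _)%N]uE -addnA; congr (_ + _)%N; last by lia.
  by apply: eq_card => j; rewrite !inE; lia.
rewrite -(sum_part aP) -(sum_part bP).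
rewrite [X in (_ = _ + X)%N](reindex_inj rev_ord_inj) /= -big_split /=.
have -> : (m * n.+1 = \sum_(i < m) n.+1)%N by rewrite sum_nat_const card_ord.
rewrite card_sig -sum1_card big_mkcond /=.
rewrite -(pair_bigA _ (fun (i : 'I_m) (j : 'I_n) => if ~~ forced0 n m a b i.+1 j.+1 &&
  ~~ forced1 n m a b i.+1 j.+1 then 1%N else 0%N)) -big_split /=.
apply: eq_bigr => i _; rewrite subnSK // -rowE -sum1_card.
by rewrite [in RHS]big_mkcond.
Qed.

(** The numbers [n + 1 - x], for [x] in [perp n a], and the entries of [a] partition [1, ..., n]. *)
Lemma sum_perp n l (a : seq nat) : (l <= n)%N -> schubert_cond n l a ->
  (\sum_(x <- perp n a) x + \sum_(x <- iota 1 n) x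
   = (n - l) * n.+1 + \sum_(x <- a) x)%N.
Proof.
move=> ln aP; have /and3P[/eqP sza srt /allP bnd] := aP.
have /and3P[/eqP szp _ _] := perp_cond aP ln.
have perpP : perm_eq (iota 1 n) ([seq (n.+1 - x)%N | x <- perp n a] ++ a).
  apply: uniq_perm; first exact: iota_uniq.
    rewrite cat_uniq (schubert_cond_uniq aP) andbT; apply/andP; split.
      rewrite map_inj_in_uniq ?filter_uniq ?iota_uniq // => x y.
      by rewrite !mem_filter !mem_iota => /andP[_ xn] /andP[_ yn]; lia.
    apply/hasPn => x xa; apply/mapP; case=> y.
    by rewrite mem_filter mem_iota => /andP[ya yn] xE; rewrite -xE xa in ya.
  move=> x; rewrite mem_cat; apply/idP/orP => [xn|].
    have [xa|xa] := boolP (x \in a); first by right.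
    left; apply/mapP; exists (n.+1 - x)%N; move: xn; rewrite mem_iota => xn.
      rewrite mem_filter mem_iota subKn ?xa; lia.
    by rewrite subKn; lia.
  case=> [/mapP[y]|/bnd]; rewrite mem_iota ?mem_filter ?mem_iota; last by lia.
  by move=> /andP[_ yn] ->; lia.
rewrite (perm_big _ perpP) /= big_cat /= big_map addnA -big_split /=.
congr (_ + _)%N; rewrite (eq_big_seq (fun=> n.+1)) => [|x].
  by rewrite big_const_seq count_predT iter_addn_0 szp mulnC.
by rewrite mem_filter mem_iota => /andP[_ xn]; lia.
Qed.

Lemma sum_succ l : (2 * \sum_(i < l) i.+1 = l * l.+1)%N.
Proof. by elim: l => [|l IHl]; rewrite ?big_ord0 // big_ord_recr /= mulnDr IHl; lia. Qed.

Section Count.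
Variables (n l : nat) (a b : seq nat).
Hypotheses (ln : (l <= n)%N) (aP : schubert_cond n l a) (bP : schubert_cond n l b).
Hypothesis pair : forall j, (1 <= j <= l)%N ->
  (n.+1 <= part a j + part b (l.+1 - j))%N.

Lemma card_freeM_codim : #|freeM n l a b|%:Z
  = (l * (n - l))%N%:Z - codim n l a - codim n l b.
Proof.
have := card_freeM aP bP pair; have := sum_succ l.
rewrite (codim_sum aP) (codim_sum bP).
move: (\sum_(x <- a) x)%N (\sum_(x <- b) x)%N (\sum_(i < l) i.+1)%N => x y z.
move: #|_| => c; have : (l * (n - l) + l * l = l * n)%N by rewrite -mulnDr subnK.
move: (l * (n - l))%N => e; rewrite !mulnS; lia.
Qed.

Lemma card_freeN_codim : #|freeM n (n - l) (perp n b) (perp n a)|%:Z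
  = (l * (n - l))%N%:Z - codim n l a - codim n l b.
Proof.
have := card_freeM (perp_cond bP ln) (perp_cond aP ln) (perp_pair ln aP bP pair).
have := sum_perp ln aP; have := sum_perp ln bP; have := sum_succ n; have := sum_succ l.
have -> : (\sum_(i < n) i.+1 = \sum_(x <- iota 1 n) x)%N.
  by rewrite -[iota 1 n]/(iota (1 + 0) n) iotaDl big_map -(big_mkord xpredT succn) /index_iota subn0.
rewrite (codim_sum aP) (codim_sum bP).
move: (\sum_(x <- a) x)%N (\sum_(x <- b) x)%N (\sum_(i < l) i.+1)%N => x y z.
move: (\sum_(x <- perp n a) x)%N (\sum_(x <- perp n b) x)%N => x' y'.
move: (\sum_(x <- _) x)%N #|_| => s c.
have : (l * (n - l) + l * l = l * n)%N by rewrite -mulnDr subnK.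
have : ((n - l) * n + l * n = n * n)%N by rewrite -mulnDl subnK.
rewrite !mulnS; move: (l * (n - l))%N ((n - l) * n)%N (l * l)%N (l * n)%N (n * n)%N.
move=> *; lia.
Qed.

End Count.

Lemma sum_last_pair (k : nat) (hk : (0 < k)%N) (c : 'I_k -> int) :
  \sum_i c i = c (last_pair hk) + \sum_(i < k.-1) c (early_pair i).
Proof.
case: k hk c => [//|k] hk c; rewrite big_ord_recr [RHS]addrC /=.
congr (_ + _); last by congr (c _); apply: val_inj.
by apply: eq_bigr => i _; congr (c _); apply: val_inj.
Qed.

Lemma sum_pairs (k : nat) (f : 'I_(2 * k) -> int) :
  \sum_(i < 2 * k) f i = \sum_(i < k) (f (pair_fst i) + f (pair_snd i)).
Proof.
(* Extending [f] by 0 to all naturals lets the induction on [k] run without changing ordinal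
   types. *)
pose g i := oapp f 0 (insub i : option 'I_(2 * k)).
have gE (i : 'I_(2 * k)) : g i = f i by rewrite /g valK.
under eq_bigr do rewrite -gE.
under [RHS]eq_bigr do rewrite -!gE /=.
elim: k {f gE} g => [|k IHk] g; first by rewrite muln0 !big_ord0.
have -> : (2 * k.+1 = (2 * k).+2)%N by lia.
by rewrite !big_ord_recr /= IHk addrA.
Qed.

(** * Solutions and points of the intersection *)

Lemma pair_cases k (i : 'I_(2 * k)) :
  exists j : 'I_k, i = pair_fst j \/ i = pair_snd j.
Proof.
have jk : (i./2 < k)%N by have := ltn_ord i; lia.
exists (Ordinal jk); have [io|ie] := boolP (odd i); [right|left];
  by apply: val_inj => /=; lia.
Qed.

Lemma last_or_early k (hk : (0 < k)%N) (j : 'I_k) :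
  j = last_pair hk \/ exists e : 'I_k.-1, j = early_pair e.
Proof.
have [jk|jk] := eqVneq (nat_of_ord j) k.-1; [left|right].
  by apply: val_inj.
have ek : (j < k.-1)%N by have := ltn_ord j; lia.
by exists (Ordinal ek); apply: val_inj.
Qed.

Section Instance.
Variables (K : fieldType) (n l k t : nat).
Hypotheses (l0 : (0 < l)%N) (ln : (l < n)%N) (hk : (0 < k)%N).
Variable alpha : 'I_(2 * k) -> seq nat.
Hypothesis alphaP : forall i, schubert_cond n l (alpha i).
Hypothesis pair : forall (i : 'I_k) (j : nat), (1 <= j <= l)%N ->
  (n.+1 <= part (alpha (pair_fst i)) j + part (alpha (pair_snd i)) (l.+1 - j))%N.
Variable F : 'I_(2 * k + t) -> nat -> {vspace 'rV[K]_n}.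
Hypothesis flagF : forall r, complete_flag (F r).
Variables (Phi : 'I_k -> 'M[K]_n) (Psi : 'I_t -> 'M[K]_(n - l, n)).
Hypothesis uPhi : forall i, Phi i \in unitmx.
Hypothesis FPhi : forall i, F (lshift t (pair_fst i)) = rows_span (Phi i).
Hypothesis FPhi' : forall i,
  F (lshift t (pair_snd i)) = rows_span (perm_mx (w0 n) *m Phi i).
Hypothesis FPsi : forall j,
  rows_span (Psi j) (n - l) = F (rshift (2 * k) j) (n - l)%N.

Definition in_instance (H : {vspace 'rV[K]_n}) : Prop :=
  (forall i, schubert_variety l (alpha i) (F (lshift t i)) H) /\
  (forall j, schubert_variety l (square_cond n l) (F (rshift (2 * k) j)) H).

Hypothesis generic : forall H, in_instance H -> forall i,
  general_position l (alpha (pair_fst i)) (alpha (pair_snd i))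
    (rows_span (Phi i)) (rows_span (perm_mx (w0 n) *m Phi i)) H.

Let Phik := Phi (last_pair hk).

Definition is_solution (MN : unknowns K n l k) : Prop :=
  [/\ coordMN hk alpha MN,
      forall i : 'I_k.-1,
        (MN.1 *m Phik) *m invmx (Phi (early_pair i)) *m MN.2 i = 0
    & forall j : 'I_t, \det (stack (ltnW ln) (MN.1 *m Phik) (Psi j)) = 0].

Let span (MN : unknowns K n l k) := rows_span (MN.1 *m Phik) l.

Lemma annihilates_span (L : 'M[K]_(l, n)) i (N : 'M[K]_(n, n - l)) :
  L *m invmx (Phi i) *m N = 0 <-> annihilates (Phi i) (rows_span L l) N.
Proof.
split=> [LN x /mem_rows_span[y _ ->]|LN].
  by rewrite -!mulmxA [L *m _]mulmxA LN mulmx0.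
apply/row_matrixP => q; rewrite !row_mul row0 LN //.
by apply/mem_rows_span; exists (delta_mx 0 q) => [j|]; rewrite -?rowE // leqNgt ltn_ord.
Qed.

Lemma det_square (L : 'M[K]_(l, n)) j : row_free L ->
  \det (stack (ltnW ln) L (Psi j)) = 0 <->
  schubert_variety l (square_cond n l) (F (rshift (2 * k) j)) (rows_span L l).
Proof.
move=> frL; have dimL : \dim (rows_span L l) = l by rewrite dim_rows_span // minnn.
have [dimF _] := flagF (rshift (2 * k) j).
have frPsi : row_free (Psi j).
  by apply: row_free_dim; rewrite FPsi dimF (minn_idPl _) // leq_subr.
rewrite (square_varietyE l0 ln (flagF _) dimL) -FPsi.
exact: det_stack_eq0.
Qed.

Lemma solution_row_free MN : is_solution MN -> row_free (MN.1 *m Phik).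
Proof.
case=> -[MP _] _ _; apply: (row_free_mul_unit (uPhi _)).
exact: coordM_row_free (alphaP _) (alphaP _) MP.
Qed.

(** The shape of [M] accounts for the last pair of conditions, the equations with [N_i] for the
    earlier pairs, the determinants for the square conditions. *)
Lemma solution_instance MN : is_solution MN -> in_instance (span MN).
Proof.
move=> sol; have frM := solution_row_free sol; case: sol => -[MP NP] MN0 det0.
split=> [i|j]; last by apply/det_square.
have dimH : \dim (span MN) = l by rewrite /span dim_rows_span // minnn.
have both j : schubert_variety l (alpha (pair_fst j)) (rows_span (Phi j)) (span MN) /\
    schubert_variety l (alpha (pair_snd j))
      (rows_span (perm_mx (w0 n) *m Phi j)) (span MN).
  have [->|[e ->]] := last_or_early hk j.
    exact: (coordM_variety (ltnW ln) (alphaP _) (alphaP _) (uPhi (last_pair hk)) MP).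
  apply: (coordN_variety (ltnW ln) (alphaP _) (alphaP _) (uPhi _) (NP e) dimH).
  by apply/annihilates_span.
have [j [->|->]] := pair_cases i; rewrite ?FPhi ?FPhi'; by case: (both j).
Qed.

(** General position at [H] gives injectivity by uniqueness of [M] and of every [N_i], and
    surjectivity by their existence. *)
Lemma solution_instance_bij : set_bij is_solution in_instance span.
Proof.
split=> [MN|MN MN' /set_mem sol /set_mem sol' E|H HI].
- exact: solution_instance.
- have HI := solution_instance sol; have gp := generic HI.
  case: MN MN' sol sol' E HI gp => [M N] [M' N'] sol sol' E HI gp.
  case: (sol) (sol') => -[MP NP] MN0 _ [[MP' NP'] MN0' _].
  congr (_, _).
    exact: (coordM_unique (ltnW ln) (alphaP _) (alphaP _) (uPhi _) MP MP'
      erefl (esym E) (gp (last_pair hk))).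
  apply/ffunP => i.
  apply: (coordN_unique (ltnW ln) (alphaP _) (alphaP _) (pair _) (uPhi _)
    (NP i) (NP' i) _ _ (gp (early_pair i))).
    by apply/annihilates_span; apply: MN0.
  by rewrite E; apply/annihilates_span; apply: MN0'.
have [HX HS] := HI; have gp := generic HI.
have Hfst i := HX (pair_fst i); have Hsnd i := HX (pair_snd i).
have [M MP MH] : exists2 M : 'M[K]_(l, n),
    coordM (alpha (pair_fst (last_pair hk))) (alpha (pair_snd (last_pair hk))) M &
    rows_span (M *m Phik) l = H.
  apply: (coordM_exists (ltnW ln) (alphaP _) (alphaP _) (uPhi _)) => //.
  - by rewrite -FPhi.
  - by rewrite -FPhi'.
have /fin_all_exists2[N NP NH] (i : 'I_k.-1) : exists2 N : 'M[K]_(n, n - l),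
    coordN (alpha (pair_fst (early_pair i))) (alpha (pair_snd (early_pair i))) N &
    annihilates (Phi (early_pair i)) H N.
  apply: (coordN_exists (ltnW ln) (alphaP _) (alphaP _) (pair _) (uPhi _)) => //.
  - by rewrite -FPhi.
  - by rewrite -FPhi'.
have frM : row_free (M *m Phik).
  by apply: (row_free_mul_unit (uPhi _)); exact: coordM_row_free (alphaP _) (alphaP _) MP.
exists (M, [ffun i => N i]) => //; split=> [|i|j] /=.
- by split=> //= i; rewrite ffunE.
- by rewrite ffunE; apply/annihilates_span; rewrite MH.
by apply/det_square => //; rewrite MH.
Qed.

End Instance.

Local Open Scope classical_set_scope.
Local Open Scope ring_scope.

Theorem theorem3p3 (R : realType) (n l k t : nat)
    (hl0 : (0 < l)%N) (hln : (l < n)%N) (hk : (0 < k)%N)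
    (alpha : 'I_(2 * k) -> seq nat)
    (hprob : schubert_problem n l (codom alpha ++ nseq t (square_cond n l)))
    (hpair : forall (i : 'I_k) (j : nat), (1 <= j <= l)%N ->
       (n.+1 <= part (alpha (pair_fst i)) j
                + part (alpha (pair_snd i)) (l.+1 - j))%N) :
  exists U : set ('I_(2 * k + t) -> nat -> {vspace 'rV[R[i]]_n}),
    [/\ zariski_open U, zariski_dense U &
    forall F, U F ->
    forall (Phi : 'I_k -> 'M[R[i]]_n) (Psi : 'I_t -> 'M[R[i]]_(n - l, n)),
      (forall i, Phi i \in unitmx) ->
      (forall i j, F (lshift t (pair_fst i)) j = rows_span (Phi i) j) ->
      (forall i j, F (lshift t (pair_snd i)) j
                   = rows_span (perm_mx (w0 n) *m Phi i) j) ->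
      (forall j, rows_span (Psi j) (n - l)
                 = F (rshift (2 * k) j) (n - l)%N) ->
      let Phik := Phi (last_pair hk) in
      let solutions : set (unknowns R[i] n l k) :=
        [set MN : unknowns R[i] n l k | [/\ coordMN hk alpha MN,
           forall i : 'I_k.-1,
             (MN.1 *m Phik) *m invmx (Phi (early_pair i)) *m MN.2 i = 0
         & forall j : 'I_t,
             \det (stack (ltnW hln) (MN.1 *m Phik) (Psi j)) = 0]] in
      let instance : set {vspace 'rV[R[i]]_n} :=
        [set H |
          (forall i : 'I_(2 * k),
             schubert_variety l (alpha i) (F (lshift t i)) H) /\
          (forall j : 'I_t,
             schubert_variety l (square_cond n l) (F (rshift (2 * k) j)) H)] in
      let vars := variables n l hk alpha in
      let eqns := equations n l k t in
      [/\ (* the common zeroes are identified with the points of the instance *)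
          set_bij solutions instance (fun MN => rows_span (MN.1 *m Phik) l),
          (* the free entries are coordinates on the space of (M, N) *)
          set_bij (@coordMN R[i] n l k hk alpha) setT
            (@free_entries R[i] n l k hk alpha),
          (* in these variables the system consists of bilinear and
             determinantal polynomials *)
          exists sys : eqns -> {mpoly R[i][#|vars|]},
            [/\ forall (i : 'I_k.-1) (p : 'I_l) (q : 'I_(n - l)),
                  bilinear_eqn i (sys (inl (i, (p, q)))),
                forall MN, coordMN hk alpha MN ->
                  forall (i : 'I_k.-1) (p : 'I_l) (q : 'I_(n - l)),
                  (sys (inl (i, (p, q)))).@[free_entries hk alpha MN]
                  = ((MN.1 *m Phik) *m invmx (Phi (early_pair i))
                       *m MN.2 i) p q
              & forall MN, coordMN hk alpha MN -> forall j : 'I_t,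
                  (sys (inr j)).@[free_entries hk alpha MN]
                  = \det (stack (ltnW hln) (MN.1 *m Phik) (Psi j))],
          (* number of variables *)
          [/\ #|vars|%:Z
              = \sum_(i < k) ((l * (n - l))%N%:Z
                  - codim n l (alpha (pair_fst i))
                  - codim n l (alpha (pair_snd i))),
              \sum_(i < k) ((l * (n - l))%N%:Z
                  - codim n l (alpha (pair_fst i))
                  - codim n l (alpha (pair_snd i)))
              = (k * (l * (n - l)))%N%:Z
                - \sum_(i < 2 * k) codim n l (alpha i)
            & (k * (l * (n - l)))%N%:Z
                - \sum_(i < 2 * k) codim n l (alpha i)
              = (k.-1 * (l * (n - l)) + t)%N%:Z]
        & (* number of equations *)
          #|eqns| = (k.-1 * (l * (n - l)) + t)%N /\ #|eqns| = #|vars|]].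
Proof.
have [/allP condP sum_codim] := hprob.
have alphaP i : schubert_cond n l (alpha i).
  by apply: condP; rewrite mem_cat codom_f.
have sum_alpha : \sum_i codim n l (alpha i) + t%:Z = (l * (n - l))%N%:Z.
  rewrite -sum_codim big_cat /= big_map big_enum /=; congr (_ + _).
  by rewrite big_nseq codim_square // iter_addr_0 natz.
(* The square conditions are included because the parameter count of [generic_position] needs total
   codimension [l(n - l)]. *)
pose al (r : 'I_(2 * k + t)) := match fintype.split r with
  | inl i => alpha i | inr _ => square_cond n l end.
have alL i : al (lshift t i) = alpha i by rewrite /al (unsplitK (inl i)).
have alR j : al (rshift (2 * k) j) = square_cond n l by rewrite /al (unsplitK (inr j)).
have alP r : schubert_cond n l (al r).
  by rewrite /al; case: (fintype.split r) => // _; apply: square_schubert_cond.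
have al_codim : \sum_r codim n l (al r) = (l * (n - l))%N%:Z.
  rewrite big_split_ord -sum_alpha /=; congr (_ + _).
    by apply: eq_bigr => i _; rewrite alL.
  under eq_bigr do rewrite alR codim_square //.
  by rewrite sumr_const card_ord natz.
have [P P0 PB] := generic_position R[i] (ltnW hln) alP al_codim.
exists (principal_open P); split; [exact: principal_open_open|exact: principal_open_dense|].
move=> F [Phi0 [uPhi0 FE PPhi0]] Phi Psi uPhi FPhi FPhi' FPsi Phik solutions instance vars eqns.
have flagF r : complete_flag (F r) by rewrite FE; apply: rows_span_complete_flag.
have FPhiE i : F (lshift t (pair_fst i)) = rows_span (Phi i) by apply/funext.
have FPhiE' i : F (lshift t (pair_snd i)) = rows_span (perm_mx (w0 n) *m Phi i).
  by apply/funext.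
(* A violation at some [H] would put the frames [Phi0], chosen with [P != 0], into the set where [P]
   vanishes. Only the flags matter here, so [Phi] may differ from [Phi0]. *)
have generic H : in_instance l alpha F H -> forall i,
    general_position l (alpha (pair_fst i)) (alpha (pair_snd i))
      (rows_span (Phi i)) (rows_span (perm_mx (w0 n) *m Phi i)) H.
  move=> [HX HS] i; rewrite -FPhiE -FPhiE' -!alL.
  apply: contrapT => ngp; case/eqP: PPhi0.
  pose y (q : 'I_(2 * k + t) * 'I_n * 'I_n) := Phi0 q.1.1 q.1.2 q.2.
  have /PB <- : exists Phi1 : 'I_(2 * k + t) -> 'M[R[i]]_n,
    [/\ forall r, Phi1 r \in unitmx, forall q, y q = Phi1 q.1.1 q.1.2 q.2
      & exists H r r', [/\ forall q, schubert_variety l (al q) (rows_span (Phi1 q)) H,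
          r != r' & ~ general_position l (al r) (al r') (rows_span (Phi1 r))
            (rows_span (Phi1 r')) H]].
    exists Phi0; split=> //; exists H, (lshift t (pair_fst i)), (lshift t (pair_snd i)).
    split; last by rewrite FE in ngp.
      move=> q; have -> : rows_span (Phi0 q) = F q by rewrite FE.
      by rewrite -(fintype.splitK q); case: (fintype.split q) => j /=; rewrite ?alL ?alR.
    by apply/eqP => /(congr1 val) /= E; lia.
  by apply: meval_eq => v; rewrite all_entriesE.
have card_vars : #|vars|%:Z = \sum_(i < k) ((l * (n - l))%N%:Z
    - codim n l (alpha (pair_fst i)) - codim n l (alpha (pair_snd i))).
  rewrite (sum_last_pair hk) card_sum card_tagged PoszD; congr (_ + _).
    by apply: card_freeM_codim => //; [exact: ltnW|exact: hpair].
  rewrite sumnE big_map big_enum /= (big_morph _ PoszD (erefl _)).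
  by apply: eq_bigr => i _; apply: card_freeN_codim => //; [exact: ltnW|exact: hpair].
have sum_two : \sum_(i < k) ((l * (n - l))%N%:Z
      - codim n l (alpha (pair_fst i)) - codim n l (alpha (pair_snd i)))
    = (k * (l * (n - l)))%N%:Z - \sum_(i < 2 * k) codim n l (alpha i).
  rewrite sum_pairs; under eq_bigr do rewrite -addrA -opprD.
  by rewrite sumrB sumr_const card_ord -mulr_natl natz.
have sum_three : (k * (l * (n - l)))%N%:Z - \sum_(i < 2 * k) codim n l (alpha i)
    = (k.-1 * (l * (n - l)) + t)%N%:Z.
  rewrite -[X in (X * _)%N](prednK hk) mulSn !PoszD -sum_alpha.
  by rewrite addrAC [X in X + _]addrAC subrr add0r addrC.
have card_eqns : #|eqns| = (k.-1 * (l * (n - l)) + t)%N.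
  by rewrite card_sum !card_prod !card_ord.
split=> //.
- exact: (solution_instance_bij hl0 hln hk alphaP hpair flagF uPhi FPhiE FPhiE' FPsi generic).
- exact: (free_entries_bij _ _ (ltnW hln) alphaP hpair).
- exists (fun e : eqns => match e with
    | inl (i, (p, q)) =>
        product_eqn l hk alpha (Phik *m invmx (Phi (early_pair i))) i p q
    | inr j => stack_eqn hk alpha (ltnW hln) Phik (Psi j) end).
  split=> [i p q|MN MNP i p q|MN MNP j].
  + exact: bilinear_product_eqn.
  + have /matrixP/(_ p q) := eval_product_eqn (Phik *m invmx (Phi (early_pair i))) i MNP.
    by rewrite mxE mulmxA => ->.
  + exact: eval_stack_eqn.
- split=> //; apply/eqP; rewrite -eqz_nat card_vars sum_two sum_three.
  by rewrite card_eqns.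
Qed.
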